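(* Let $\alpha$ be an ordinal and let $(G_j)_{j\le\alpha}$ be an iterated rational extension. \begin{enumerate} \item The embedding $G_0\to G_\alpha$ is isometric for $\operatorname{scl}$. \item Suppose that the iterated rational extension is malnormal and that $\operatorname{scl}_{G_0}(g)>0$ for all $e\neq g\in G_0$. Then $\operatorname{scl}_{G_\alpha}(g)>0$ for all $e\neq g\in G_\alpha$. \end{enumerate}
   Context: Given a subgroup $A$ of $\mathbb{Q}$, a group $G$ and a subgroup $Z<G$ isomorphic to a subgroup of $A$, the amalgamated product $G*_ZA$ is a rational extension of $G$; it is malnormal if $Z$ is malnormal in $G$ (i.e. $Z\cap gZg^{-1}=\{e\}$ for all $g\in G\setminus Z$). An iterated rational extension is a family of groups $(G_j)_{j\le\alpha}$ indexed by ordinals, with $G_j\le G_{j'}$ for $j\le j'$, such that each $G_{j+1}$ is a rational extension of $G_j$ (for some subgroup $A$ of $\mathbb{Q}$ depending on $j$), and for each limit ordinal $\beta\le\alpha$, $G_\beta$ is the directed union of $(G_j)_{j<\beta}$. It is an iterated malnormal rational extension if all the rational extensions involved are malnormal. For elements: $\operatorname{scl}_G(g)=\lim_n\operatorname{cl}_G(g^n)/n$ for $g\in[G,G]$ ($\operatorname{cl}_G$ = commutator length), $\operatorname{scl}_G(g)=\operatorname{scl}_G(g^k)/k$ if $g^k\in[G,G]$, and $\infty$ otherwise. On chains: $\operatorname{C}_1(G)$ is the real vector space with basis $G$; for an integral chain $c=\sum_ig_i$, $\operatorname{cl}_G(c)$ is the minimal number of commutators whose product equals some $\prod_it_ig_it_i^{-1}$,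 and $\operatorname{scl}_G(c)=\lim_n\operatorname{cl}_G(\sum_ig_i^n)/n$, extended by homogeneity and continuity to real chains (value $\infty$ off boundaries). $\operatorname{C}_1^H(G)$ is $\operatorname{C}_1(G)$ modulo the span of all $g^n-ng$ and $hgh^{-1}-g$. A homomorphism $G_1\to G_2$ is isometric for $\operatorname{scl}$ if the induced map $\operatorname{C}_1^H(G_1)\to\operatorname{C}_1^H(G_2)$ preserves $\operatorname{scl}$, including infinite values. *)

(* Defs.v *)
From HB Require Import structures.
From mathcomp Require Import all_boot all_order all_algebra.
From mathcomp Require Import reals Rstruct constructive_ereal.
From Stdlib Require Import ClassicalEpsilon.

Set Implicit Arguments.
Unset Strict Implicit.
Unset Printing Implicit Defensive.

Import Order.TTheory GRing.Theory Num.Theory.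

Notation RR := Rdefinitions.R.

Section Groups.
Variable U : groupType.
Local Open Scope group_scope.

Definition is_subgroup (S : U -> Prop) : Prop :=
  S 1 /\ (forall x y, S x -> S y -> S (x * y)) /\ (forall x, S x -> S x^-1).

Definition commutator (a b : U) : U := a * b * a^-1 * b^-1.

Definition cl_le (S : U -> Prop) (gs : seq U) (n : nat) : Prop :=
  exists (ts : seq U) (ab : seq (U * U)),
    size ts = size gs /\ (forall t, t \in ts -> S t) /\
    size ab = n /\ (forall p, p \in ab -> S p.1 /\ S p.2) /\
    foldr (fun tg acc => tg.1 * tg.2 * tg.1^-1 * acc) 1 (zip ts gs)
    = foldr (fun p acc => commutator p.1 p.2 * acc) 1 ab.

Definition in_commutator_subgroup (S : U -> Prop) (g : U) : Prop :=
  exists ab : seq (U * U), (forall p, p \in ab -> S p.1 /\ S p.2) /\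
    g = foldr (fun p acc => commutator p.1 p.2 * acc) 1 ab.

End Groups.


Local Open Scope ring_scope.

Definition converges_to (u : nat -> RR) (L : RR) : Prop :=
  forall eps : RR, 0 < eps -> exists N : nat, forall n, (N <= n)%N ->
    `|u n - L| < eps.

Definition seq_limit (u : nat -> RR) : RR :=
  match excluded_middle_informative (exists L, converges_to u L) with
  | left h => proj1_sig (constructive_indefinite_description _ h)
  | right _ => 0
  end.

Section Scl.
Variable U : groupType.
Variable S : U -> Prop.

(* commutator length of the integral chain  sum_i gs_i  in the group S,
   valued in the extended reals (+oo if there is no such expression) *)
Definition cl_leb (gs : seq U) (n : nat) : bool :=
  if excluded_middle_informative (cl_le S gs n) then true else false.

Lemma cl_lebP gs n : cl_le S gs n -> cl_leb gs n.
Proof. by rewrite /cl_leb; case: excluded_middle_informative. Qed.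

Definition cl (gs : seq U) : \bar RR :=
  match excluded_middle_informative (exists n, cl_le S gs n) with
  | left h => ((ex_minn (P := cl_leb gs)
                  (let: ex_intro n hn := h in
                   ex_intro _ n (cl_lebP hn)))%:R)%:E
  | right _ => +oo%E
  end.

Definition powseq (gs : seq U) (n : nat) : seq U := [seq (g ^+ n)%g | g <- gs].

(* scl of an integral chain sum_i gs_i :  lim_n cl(sum_i gs_i^n)/n, where,
   as for elements, if only some multiple k*c has finite commutator length
   one uses scl(c) = scl(k c)/k (for some such k; the value does not depend
   on the choice). *)
Definition scl_int (gs : seq U) : \bar RR :=
  match excluded_middle_informative
          (exists k : nat, (0 < k)%N /\ (cl (powseq gs k) < +oo)%E) with
  | left h =>
      let k := proj1_sig (constructive_indefinite_description _ h) in
      (seq_limit (fun n => fine (cl (powseq gs (k * n.+1))) / n.+1%:R)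
        / k%:R)%:E
  | right _ => +oo%E
  end.

(* integral chain sum_i m_i g_i, with m_i g_i read as |m_i| copies of
   g_i^{sign m_i} (as in C_1^H, where -g = g^{-1}) *)
Definition int_chain_elems (c : seq (int * U)) : seq U :=
  flatten [seq nseq `|p.1|%N (if (0 <= p.1)%R then p.2 else (p.2^-1)%g) | p <- c].

(* rational chains: extension by homogeneity, scl(c) = scl(N c)/N with N the
   least common denominator *)
Definition chain_denom (c : seq (rat * U)) : nat :=
  foldr (fun p acc => lcmn `|denq p.1|%N acc) 1%N c.

Definition rat_to_int_chain (c : seq (rat * U)) : seq (int * U) :=
  let N := chain_denom c in
  [seq ((numq p.1 * (N %/ `|denq p.1|)%N%:Z)%R, p.2) | p <- c].

Definition scl_rat (c : seq (rat * U)) : \bar RR :=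
  mule (scl_int (int_chain_elems (rat_to_int_chain c)))
       ((chain_denom c)%:R^-1)%:E.

(* real chains sum_i r_i g_i: rational chains use scl_rat; otherwise the value
   is obtained by continuity (in the coefficients, with the same g_i) from the
   rational chains on which scl is finite, i.e. the rational boundaries, and
   is +oo off boundaries (i.e. when no such rational chain is close). *)
Definition rat_approx (c : seq (RR * U)) (q : seq rat) (d : RR) : Prop :=
  size q = size c /\ (scl_rat (zip q (map snd c)) < +oo)%E /\
  forall i, (i < size c)%N -> `|ratr (nth 0 q i) - nth 0 (map fst c) i| < d.

Definition scl_cont_limit (c : seq (RR * U)) (L : RR) : Prop :=
  forall eps : RR, 0 < eps -> exists d : RR, 0 < d /\
    forall q, rat_approx c q d ->
      `|fine (scl_rat (zip q (map snd c))) - L| < eps.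

Definition scl (c : seq (RR * U)) : \bar RR :=
  match excluded_middle_informative
          (exists q : seq rat, map ratr q = map fst c) with
  | left h => scl_rat (zip (proj1_sig (constructive_indefinite_description _ h))
                          (map snd c))
  | right _ =>
    match excluded_middle_informative
       ((forall d : RR, 0 < d -> exists q, rat_approx c q d) /\
        exists L, scl_cont_limit c L) with
    | left h => (proj1_sig (constructive_indefinite_description _
                              (proj2 h)))%:E
    | right _ => +oo%E
    end
  end.

Definition scl_comm (g : U) : RR :=
  seq_limit (fun n => fine (cl [:: (g ^+ n.+1)%g]) / n.+1%:R).

Definition scl_elt (g : U) : \bar RR :=
  match excluded_middle_informative (in_commutator_subgroup S g) with
  | left _ => (scl_comm g)%:E
  | right _ =>
    match excluded_middle_informative
      (exists k : nat, (0 < k)%N /\ in_commutator_subgroup S (g ^+ k)%g) with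
    | left h =>
        let k := proj1_sig (constructive_indefinite_description _ h) in
        (scl_comm (g ^+ k)%g / k%:R)%:E
    | right _ => +oo%E
    end
  end.

End Scl.

Definition is_rat_subgroup (A : rat -> Prop) : Prop :=
  A 0 /\ (forall a b, A a -> A b -> A (a + b)) /\ (forall a, A a -> A (- a)).

Definition hom_on (U K : groupType) (G : U -> Prop) (f : U -> K) : Prop :=
  forall x y, G x -> G y -> f (x * y)%g = (f x * f y)%g.

Definition rat_hom_on (K : groupType) (A : rat -> Prop) (f : rat -> K) : Prop :=
  forall a b, A a -> A b -> f (a + b) = (f a * f b)%g.

Definition malnormal (U : groupType) (G Z : U -> Prop) : Prop :=
  forall g, G g -> ~ Z g ->
    forall x, Z x -> (exists z, Z z /\ x = (g * z * g^-1)%g) -> x = 1%g.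

(* [amalgam_over G H A Z phi psi] : the subgroup H of U (containing G), with
   the inclusion G -> H and psi : A -> H, is the amalgamated product G *_Z A,
   where Z < G is identified with a subgroup of A by the injective
   homomorphism phi; i.e. H is the pushout of G <- Z -> A in the category of
   groups (universal property). *)
Definition amalgam_over (U : groupType) (G H : U -> Prop) (A : rat -> Prop)
    (Z : U -> Prop) (phi : U -> rat) (psi : rat -> U) : Prop :=
  is_rat_subgroup A /\ is_subgroup Z /\ (forall z, Z z -> G z) /\
  (forall x y, Z x -> Z y -> phi (x * y)%g = phi x + phi y) /\
  (forall z, Z z -> A (phi z)) /\
  (forall x y, Z x -> Z y -> phi x = phi y -> x = y) /\
  rat_hom_on A psi /\ (forall a, A a -> H (psi a)) /\
  (forall z, Z z -> psi (phi z) = z) /\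
  (forall x, G x -> H x) /\
  forall (K : groupType) (f : U -> K) (g : rat -> K),
    hom_on G f -> rat_hom_on A g -> (forall z, Z z -> f z = g (phi z)) ->
    exists h : U -> K,
      (hom_on H h /\ (forall x, G x -> h x = f x) /\
       (forall a, A a -> h (psi a) = g a)) /\
      forall h' : U -> K,
        hom_on H h' -> (forall x, G x -> h' x = f x) ->
        (forall a, A a -> h' (psi a) = g a) -> forall x, H x -> h' x = h x.

Definition rational_extension (U : groupType) (G H : U -> Prop) : Prop :=
  exists A Z phi psi, @amalgam_over U G H A Z phi psi.

Definition malnormal_rational_extension (U : groupType) (G H : U -> Prop) : Prop :=
  exists A Z phi psi, @amalgam_over U G H A Z phi psi /\ malnormal G Z.

(* lt is a well-order on I (so I is order-isomorphic to an ordinal) *)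
Definition well_order (I : Type) (lt : I -> I -> Prop) : Prop :=
  (forall i, ~ lt i i) /\
  (forall i j k, lt i j -> lt j k -> lt i k) /\
  (forall i j, lt i j \/ i = j \/ lt j i) /\
  well_founded lt.

Definition is_succ (I : Type) (lt : I -> I -> Prop) (j k : I) : Prop :=
  lt j k /\ forall m, lt j m -> m = k \/ lt k m.

Definition is_limit (I : Type) (lt : I -> I -> Prop) (b : I) : Prop :=
  (exists j, lt j b) /\ ~ (exists j, is_succ lt j b).

Definition iterated_extension (U : groupType)
    (ext : (U -> Prop) -> (U -> Prop) -> Prop)
    (I : Type) (lt : I -> I -> Prop) (S : I -> U -> Prop) : Prop :=
  (forall j, is_subgroup (S j)) /\
  (forall j j' x, lt j j' -> S j x -> S j' x) /\
  (forall j k, is_succ lt j k -> ext (S j) (S k)) /\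
  (forall b, is_limit lt b -> forall x, S b x <-> exists j, lt j b /\ S j x).

(* the inclusion G -> H (G <= H) is isometric for scl on real chains
   (equivalently on C_1^H, since scl factors through C_1^H) *)
Definition scl_isometric (U : groupType) (G H : U -> Prop) : Prop :=
  forall c : seq (RR * U), (forall p, p \in c -> G p.2) ->
    scl H c = scl G c.

(* Main.v *)
Require Import Defs.
From HB Require Import structures.
From mathcomp Require Import all_boot all_order all_algebra.
From mathcomp Require Import boolp classical_sets reals Rstruct constructive_ereal.
From mathcomp Require Import zify ring lra.
From Stdlib Require Import ClassicalEpsilon.

Set Implicit Arguments.
Unset Strict Implicit.
Unset Printing Implicit Defensive.

Import Order.TTheory GRing.Theory Num.Theory.

(* Let [H = G *_Z A] with [A] a subgroup of the rationals.

   Isometry. If [Z] is nontrivial, [A / Z] is torsion, and [H] maps to the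
   wreath product of [G] by [A / Z] so that [G] goes to the diagonal. Given an
   equation [x = [a1, b1] ... [am, bm]] in [H] with [x] in [G], the shifts
   involved generate a finite cyclic group of some order [n]; multiplying the
   [n] coordinates of the equation gives [x ^ n] as a word of length [4 n m] in
   [G] in which every letter occurs as often as its inverse, and such a word is
   a product of [n m] commutators. Hence [cl_G (x ^ n) <= n cl_H x]. (If [Z] is
   trivial, [G] is a retract of [H].) Stably this gives [scl_G <= scl_H], and
   the statement passes to unions because an equation involves only finitely
   many elements.

   Positivity. An element of [H] conjugate into [G] or [A] is treated by the
   isometry, since a power of an element of [A] lies in [Z]. Any other element
   is conjugate to some [h] given by a reduced word of even length. Counting
   the occurrences of [h ^ 2] minus those of its inverse along reduced words is
   a quasimorphism. By malnormality the action on the Bass-Serre tree is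
   acylindrical, and [H] is torsion-free, so no translate of the axis of [h]
   overlaps it backwards along two periods: the inverse of [h ^ 2] never occurs
   in a power of [h], and the quasimorphism grows linearly on these powers. *)

Ltac grp := rewrite ?(invgM, invgK, invg1, mul1g, mulg1, mulgA, mulgK, mulgVK, mulgV, mulVg) //.

(** * Products of commutators *)

Section CommutatorProducts.
Variables (U : groupType) (S : U -> Prop).
Local Open Scope group_scope.

(** In a subgroup [k] acts as an upper bound, since trivial commutators can pad the list; minimal
    commutator lengths are thus avoided. *)
Definition comm_prod (k : nat) (x : U) : Prop :=
  exists ab : seq (U * U), size ab = k /\ (forall p, p \in ab -> S p.1 /\ S p.2) /\
    x = foldr (fun p acc => commutator p.1 p.2 * acc) 1 ab.

Hypothesis hS : is_subgroup S.

Lemma sub1 : S 1. Proof. by case: hS. Qed.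
Lemma subM x y : S x -> S y -> S (x * y). Proof. by case: hS => _ [h _]; apply: h. Qed.
Lemma subV x : S x -> S x^-1. Proof. by case: hS => _ [_]; apply. Qed.
Lemma subX x n : S x -> S (x ^+ n).
Proof. by move=> hx; elim: n => [|n IH]; [exact: sub1 | rewrite expgS; exact: subM]. Qed.
Lemma sub_prod (I : eqType) (l : seq I) (F : I -> U) :
  (forall i, i \in l -> S (F i)) -> S (\prod_(i <- l) F i).
Proof.
elim: l => [|i l IH] h; first by rewrite big_nil; exact: sub1.
rewrite big_cons; apply: subM; first by apply: h; rewrite mem_head.
by apply: IH => j hj; apply: h; rewrite in_cons hj orbT.
Qed.

Lemma comm_prod0 : comm_prod 0 1. Proof. by exists [::]. Qed.

Lemma comm_prod_cons k a b x :
  S a -> S b -> comm_prod k x -> comm_prod k.+1 (commutator a b * x).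
Proof.
move=> ha hb [ab [<- [hab ->]]]; exists ((a, b) :: ab); split=> //; split=> // p.
by rewrite in_cons => /predU1P[->|/hab].
Qed.

Lemma comm_prodP k x : comm_prod k.+1 x <->
  exists a b y, [/\ S a, S b, comm_prod k y & x = commutator a b * y].
Proof.
split=> [[[|p ab] [//= hs [h ->]]]|[a [b [y [ha hb hy ->]]]]]; last exact: comm_prod_cons.
have {}hs : size ab = k by case: hs.
have [h1 h2] := h p (mem_head _ _).
exists p.1, p.2, (foldr (fun p acc => commutator p.1 p.2 * acc) 1 ab); split=> //.
by exists ab; split=> //; split=> // q hq; apply: h; rewrite in_cons hq orbT.
Qed.

Lemma comm_prod_0E x : comm_prod 0 x -> x = 1.
Proof. by case=> ab [/size0nil -> [_ ->]]. Qed.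

Lemma comm_prod_sub k x : comm_prod k x -> S x.
Proof.
elim: k x => [|k IH] x; first by move/comm_prod_0E ->; exact: sub1.
move/comm_prodP => [a [b [y [ha hb /IH hy ->]]]].
by rewrite /commutator; do !apply: subM => //; exact: subV.
Qed.

Lemma comm_prodM k l x y : comm_prod k x -> comm_prod l y -> comm_prod (k + l) (x * y).
Proof.
move=> hx hy; elim: k x hx => [|k IH] x; first by move/comm_prod_0E ->; rewrite mul1g.
move/comm_prodP => [a [b [z [ha hb /IH hz ->]]]].
by rewrite addSn -mulgA; apply: comm_prod_cons.
Qed.

Lemma comm_prod_comm a b : S a -> S b -> comm_prod 1 (commutator a b).
Proof. by move=> ha hb; rewrite -[commutator _ _]mulg1; apply: comm_prod_cons => //; exact: comm_prod0. Qed.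

Lemma comm_prod1 k : comm_prod k 1.
Proof.
elim: k => [|k IH]; first exact: comm_prod0.
have -> : 1 = commutator 1 1 * 1 :> U by rewrite /commutator; grp.
by apply: comm_prod_cons => //; exact: sub1.
Qed.

Lemma comm_prodW k l x : (k <= l)%N -> comm_prod k x -> comm_prod l x.
Proof.
by move=> /subnKC <- h; rewrite -[x]mulg1; apply: comm_prodM => //; exact: comm_prod1.
Qed.

Lemma comm_prodJ k t x : S t -> comm_prod k x -> comm_prod k (t * x * t^-1).
Proof.
move=> ht; elim: k x => [|k IH] x.
  by move/comm_prod_0E ->; rewrite mulg1 mulgV; exact: comm_prod0.
move/comm_prodP => [a [b [z [ha hb /IH hz ->]]]].
have -> : t * (commutator a b * z) * t^-1 =
  commutator (t * a * t^-1) (t * b * t^-1) * (t * z * t^-1).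
  by rewrite /commutator; grp.
by apply: comm_prod_cons => //; do !apply: subM => //; exact: subV.
Qed.

Lemma comm_prodX k n x : comm_prod k x -> comm_prod (n * k) (x ^+ n).
Proof.
move=> h; elim: n => [|n IH]; first exact: comm_prod0.
by rewrite expgS mulSn; apply: comm_prodM.
Qed.

(** The quotient [x * y^-1] measures how far apart [x] and [y] are. With the next two lemmas this
    gives a calculus for replacing factors of a product at a known cost in commutators. *)
Lemma comm_prod_div_mul k l x x' y y' : S x ->
  comm_prod k (x * y^-1) -> comm_prod l (x' * y'^-1) ->
  comm_prod (l + k) (x * x' * (y * y')^-1).
Proof.
move=> hx h1 h2.
have -> : x * x' * (y * y')^-1 = (x * (x' * y'^-1) * x^-1) * (x * y^-1) by grp.
by apply: comm_prodM => //; apply: comm_prodJ.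
Qed.

Lemma comm_prod_div_trans k l x y z :
  comm_prod k (x * y^-1) -> comm_prod l (y * z^-1) -> comm_prod (k + l) (x * z^-1).
Proof.
move=> h1 h2; have -> : x * z^-1 = (x * y^-1) * (y * z^-1) by grp.
exact: comm_prodM.
Qed.

Lemma comm_prod_div k l x y :
  comm_prod k (x * y^-1) -> comm_prod l y -> comm_prod (k + l) x.
Proof. by move=> h1 h2; rewrite -(mulgVK y x); exact: comm_prodM. Qed.

(** Up to conjugation by [x * y], each induction step moves one [y] across [x ^+ n], at the cost of
    one commutator. *)
Lemma comm_prod_expM n x y : S x -> S y ->
  comm_prod n (x ^+ n * y ^+ n * ((x * y) ^+ n)^-1).
Proof.
move=> hx hy; elim: n => [|n IH]; first by rewrite !expg0; grp; exact: comm_prod0.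
have -> : x ^+ n.+1 * y ^+ n.+1 * (x * y) ^- n.+1 =
   (x * y) * (commutator y^-1 (x ^+ n) * (x ^+ n * y ^+ n * (x * y) ^- n)) * (x * y)^-1.
  by rewrite expgSr [y ^+ _]expgSr [(x * y) ^+ n.+1]expgS /commutator -(expgSr y) expgS -(expgSr x) (expgS x); grp.
apply: comm_prodJ; first exact: subM.
by apply: comm_prod_cons => //; [exact: subV | exact: subX].
Qed.

Variable gs : seq U.
Hypothesis hgs : forall g, g \in gs -> S g.

(** For each entry, [g ^+ m] has to cross the product of the [n]-th powers of the later entries,
    which costs one commutator. This is the subadditivity defect [size gs] in the estimates on
    [scl]. *)
Lemma comm_prod_powD n m :
  comm_prod (size gs) (\prod_(g <- gs) g ^+ (n + m) *
    ((\prod_(g <- gs) g ^+ n) * (\prod_(g <- gs) g ^+ m))^-1).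
Proof.
elim: gs hgs => [|g l IH] h; first by rewrite !big_nil; grp; exact: comm_prod0.
have hg : S g by apply: h; rewrite mem_head.
have hl : forall x, x \in l -> S x by move=> x hx; apply: h; rewrite in_cons hx orbT.
rewrite !big_cons /=.
set a := \prod_(j <- l) _; set b := \prod_(j <- l) _; set c := \prod_(j <- l) _.
have -> : g ^+ (n + m) * a * (g ^+ n * b * (g ^+ m * c))^-1 =
  (g ^+ (n + m) * (a * (b * c)^-1) * (g ^+ (n + m))^-1) *
  (g ^+ n * (commutator (g ^+ m) b) * (g ^+ n)^-1).
  by rewrite /commutator expgnDr; grp.
have hb : S b by apply: sub_prod => x hx; apply/subX/hl.
rewrite -addn1; apply: comm_prodM; apply: comm_prodJ; try exact: subX.
  exact: IH.
by apply: comm_prod_comm => //; apply: subX.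
Qed.

Lemma comm_prod_pow_prod n :
  comm_prod (n * size gs) (\prod_(g <- gs) g ^+ n * ((\prod_(g <- gs) g) ^+ n)^-1).
Proof.
elim: gs hgs => [|g l IH] h; first by rewrite !big_nil expg1n; grp; exact: comm_prod1.
have hg : S g by apply: h; rewrite mem_head.
have hl : forall x, x \in l -> S x by move=> x hx; apply: h; rewrite in_cons hx orbT.
rewrite !big_cons /= mulnS addnC.
apply: (@comm_prod_div_trans _ _ _ (g ^+ n * (\prod_(j <- l) j) ^+ n)).
  have -> : forall a b c : U, a * b * (a * c)^-1 = a * (b * c^-1) * a^-1 by move=> a b c; grp.
  by apply: comm_prodJ; [exact: subX | exact: IH].
by apply: comm_prod_expM => //; apply: sub_prod.
Qed.

(** Trading [t * g * t^-1] for [g] costs the commutator of [g] and [t], so dropping all conjugators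
    costs [size gs]. For the chains of [n]-th powers this is independent of [n], hence invisible in
    the limit. *)
Lemma cl_le_comm_prod k :
  cl_le S gs k -> comm_prod (size gs + k) (\prod_(g <- gs) g).
Proof.
move=> [ts [ab [hsz [hts [hab [hab' e]]]]]].
have : comm_prod k (foldr (fun tg acc => tg.1 * tg.2 * tg.1^-1 * acc) 1 (zip ts gs)).
  by rewrite e; exists ab.
apply: comm_prod_div => {ab hab hab' e}.
elim: gs hgs ts hsz hts => [|g l IH] h [|t ts] //=.
  by move=> _ _; rewrite big_nil; grp; exact: comm_prod0.
move=> [hsz] hts.
have hg : S g by apply: h; rewrite mem_head.
have hl : forall x, x \in l -> S x by move=> x hx; apply: h; rewrite in_cons hx orbT.
have ht : S t by apply: hts; rewrite mem_head.
rewrite big_cons -addn1; apply: comm_prod_div_mul => //.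
  have -> : g * (t * g * t^-1)^-1 = commutator g t by rewrite /commutator; grp.
  exact: comm_prod_comm.
by apply: IH => // x hx; apply: hts; rewrite in_cons hx orbT.
Qed.

Lemma comm_prod_cl_le k : comm_prod k (\prod_(g <- gs) g) -> cl_le S gs k.
Proof.
case=> ab [hs [hab e]]; exists (nseq (size gs) 1), ab.
rewrite size_nseq; do !split=> //.
  by move=> t /nseqP[-> _]; exact: sub1.
rewrite -e; elim: gs => [|g l IH] /=; first by rewrite big_nil.
by rewrite big_cons IH; grp.
Qed.

End CommutatorProducts.

Lemma comm_prod_mono (U : groupType) (S T : U -> Prop) k x :
  (forall y, S y -> T y) -> comm_prod S k x -> comm_prod T k x.
Proof.
by move=> h [ab [hs [hab e]]]; exists ab; do !split=> //; apply: h; case: (hab _ H).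
Qed.

(** * Stable commutator length as an infimum *)

Section SclLimit.
Local Open Scope ring_scope.
Variables (U : groupType) (S : U -> Prop).

Definition clpow (gs : seq U) (n k : nat) : Prop :=
  comm_prod S k (\prod_(g <- gs) g ^+ n)%g.

(* For a subgroup [S] containing the entries of [gs], this says
   [scl_S (sum gs) < L]: the sequence [clpow] is subadditive up to [size gs],
   so the limit is the infimum over [n] of [(clpow n + size gs) / n]. *)
Definition scl_lt (gs : seq U) (L : RR) : Prop :=
  exists n k : nat, [/\ (0 < n)%N, clpow gs n k & (k + size gs)%:R < L * n%:R].

Definition is_scl (gs : seq U) (L : RR) : Prop :=
  (forall n k, (0 < n)%N -> clpow gs n k -> L * n%:R <= (k + size gs)%:R) /\
  (forall e, 0 < e -> scl_lt gs (L + e)).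

Lemma is_scl_exists gs :
  (exists n k, (0 < n)%N /\ clpow gs n k) -> exists L, is_scl gs L.
Proof.
move=> [n0 [k0 [n0p h0]]].
pose E : set RR := fun x => exists n k, [/\ (0 < n)%N, clpow gs n k & x = (k + size gs)%:R / n%:R].
have hE : has_inf E.
  split; first by exists ((k0 + size gs)%:R / n0%:R), n0, k0.
  by exists 0 => x [n [k [_ _ ->]]]; rewrite divr_ge0.
exists (inf E); split=> [n k np h|e ep].
  rewrite -ler_pdivlMr ?ltr0n //; apply: (ge_inf (proj2 hE)).
  by exists n, k.
have [x [n [k [np h ->]]] hx] := inf_adherent ep hE.
by exists n, k; split=> //; rewrite -ltr_pdivrMr ?ltr0n.
Qed.

Lemma is_scl_uniq gs L : is_scl gs L -> forall M, scl_lt gs M <-> L < M.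
Proof.
move=> [h1 h2] M; split=> [[n [k [np h lt]]]|lt].
  have := le_lt_trans (h1 n k np h) lt.
  by rewrite ltr_pM2r ?ltr0n.
by have := h2 (M - L); rewrite subr_gt0 [L + _]addrC subrK; apply.
Qed.

Hypothesis hS : is_subgroup S.

Lemma clpowD gs n m k l : (forall g, g \in gs -> S g) ->
  clpow gs n k -> clpow gs m l -> clpow gs (n + m) (k + l + size gs).
Proof.
move=> hgs hk hl; rewrite [(k + l + _)%N]addnC; apply: (comm_prod_div (comm_prod_powD hS hgs n m)).
exact: comm_prodM.
Qed.

Lemma clpow_muln gs n k j : (forall g, g \in gs -> S g) ->
  clpow gs n k -> clpow gs (j * n) (j * (k + size gs)).
Proof.
move=> hgs h; elim: j => [|j IH]; last first.
  by rewrite !mulSn -addnA [(size gs + _)%N]addnC addnA; apply: clpowD.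
by rewrite /clpow !mul0n; under eq_bigr do rewrite expg0; rewrite big1 //; exact: comm_prod0.
Qed.

Lemma clpow_cl_le gs n k : (forall g, g \in gs -> S g) ->
  clpow gs n k -> cl_le S (powseq gs n) k.
Proof.
move=> hgs h; apply: comm_prod_cl_le => //.
by rewrite big_map.
Qed.

Lemma cl_le_clpow gs n k : (forall g, g \in gs -> S g) ->
  cl_le S (powseq gs n) k -> clpow gs n (size gs + k).
Proof.
move=> hgs h; rewrite /clpow -(size_map (fun g => g ^+ n)%g gs) -(big_map _ xpredT (fun x => x)).
apply: cl_le_comm_prod => // _ /mapP[g /hgs hg ->]; exact: subX.
Qed.

Lemma clP gs k : cl_le S gs k ->
  exists m : nat, [/\ cl S gs = (m%:R)%:E, cl_le S gs m & forall l, cl_le S gs l -> (m <= l)%N].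
Proof.
move=> h; rewrite /cl; case: excluded_middle_informative => [h'|]; last by case; exists k.
case: ex_minnP => m hm hmin; exists m; split=> //.
  by move: hm; rewrite /cl_leb; case: excluded_middle_informative.
by move=> l /cl_lebP /hmin.
Qed.

Lemma cl_ltP gs : (cl S gs < +oo)%E -> exists k, cl_le S gs k.
Proof. by rewrite /cl; case: excluded_middle_informative. Qed.

(** Fekete's argument: a nearly optimal exponent [n1] is used [q * k0] times and the remainder is
    filled with [s] copies of the witness at [k0]. The limit is [k0 * L] because only multiples of
    [k0], where the commutator length is finite, are sampled. *)
Lemma cl_converges gs L k0 m0 : (forall g, g \in gs -> S g) -> is_scl gs L ->
  (0 < k0)%N -> clpow gs k0 m0 ->
  converges_to (fun n => fine (cl S (powseq gs (k0 * n.+1))) / n.+1%:R) (k0%:R * L).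
Proof.
move=> hgs [Llb Linf] k0p hk0 eps ep.
have k0p' : 0 < k0%:R :> RR by rewrite ltr0n.
have e2 : 0 < eps / (2 * k0%:R) by rewrite divr_gt0 // mulr_gt0.
have [n1 [k1 [n1p h1 lt1]]] := Linf _ e2.
(* [C] covers the at most [n1] remainder blocks and one gluing; the summand [2 * p] pays for the
   conjugators in [cl] and for [size gs] in the lower bound of [is_scl]. *)
pose p := size gs; pose C := (n1 * (m0 + p) + p + 2 * p)%N.
exists (Num.trunc (2 * C%:R / eps)) => n hn.
set N := n.+1.
have Np : 0 < N%:R :> RR by rewrite ltr0n.
have hC : C%:R / N%:R < eps / 2.
  have := truncnS_gt (2 * C%:R / eps).
  have : (Num.trunc (2 * C%:R / eps)).+1%:R <= N%:R :> RR by rewrite ler_nat.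
  move=> a b; have {a b} := lt_le_trans b a.
  by rewrite ltr_pdivrMr // ltr_pdivrMr // ; lra.
pose q := (N %/ n1)%N; pose s := (N %% n1)%N.
have hN : N = (q * n1 + s)%N by exact: divn_eq.
have hcl : clpow gs (k0 * N) (q * k0 * (k1 + p) + s * (m0 + p) + p).
  rewrite {1}hN mulnDr [(k0 * s)%N]mulnC mulnA [(k0 * q)%N]mulnC.
  by apply: clpowD => //; apply: clpow_muln.
have hcl' := clpow_cl_le hgs hcl.
have [x [-> hx hxmin]] := clP hcl'.
have {hxmin hcl hcl'} up := hxmin _ hcl'.
have k0N : (0 < k0 * N)%N by rewrite muln_gt0 k0p.
have {hx} low := Llb _ _ k0N (cl_le_clpow hgs hx).
rewrite /=.
have sn1 : (s <= n1)%N by exact/ltnW/ltn_pmod.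
have qn1 : (q * n1)%:R <= N%:R :> RR by rewrite ler_nat hN leq_addr.
have up2 : (x <= q * k0 * (k1 + p) + C)%N.
  apply: leq_trans up _; rewrite /C; have := leq_mul sn1 (leqnn (m0 + p)); lia.
have low2 : L * (k0%:R * N%:R) <= x%:R + C%:R.
  rewrite -natrM; apply: le_trans low _; rewrite -natrD ler_nat /C -/p; lia.
have up3 : x%:R <= (k0%:R * L + eps / 2) * N%:R + C%:R.
  move: up2; rewrite -(ler_nat RR) => /le_trans; apply.
  rewrite natrD lerD2r !natrM.
  have a1 : (k1 + p)%:R * q%:R <= (L + eps / (2 * k0%:R)) * n1%:R * q%:R :> RR.
    by rewrite ler_wpM2r // ltW.
  have a2 : 0 <= L + eps / (2 * k0%:R).
    have /ltW := le_lt_trans (ler0n RR _) lt1; rewrite pmulr_lge0 // ltr0n //.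
  have a3 : (L + eps / (2 * k0%:R)) * (n1%:R * q%:R) <= (L + eps / (2 * k0%:R)) * N%:R.
    by rewrite ler_wpM2l // mulrC -natrM.
  have -> : k0%:R * L + eps / 2 = (L + eps / (2 * k0%:R)) * k0%:R by field; rewrite lt0r_neq0.
  have a4 : k0%:R * ((k1 + p)%:R * q%:R) <= k0%:R * ((L + eps / (2 * k0%:R)) * N%:R).
    by rewrite ler_wpM2l //; apply: le_trans a1 _; rewrite -mulrA.
  by apply: le_trans (le_trans _ a4) _; rewrite le_eqVlt; apply/orP; left; apply/eqP; ring.
rewrite ltr_norml; apply/andP; split.
  rewrite -(ltr_pM2r Np) mulrBl divfK ?lt0r_neq0 //.
  move: hC; rewrite ltr_pdivrMr // => hC.
  have := mulr_gt0 ep Np; move: low2 hC; lra.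
rewrite -(ltr_pM2r Np) mulrBl divfK ?lt0r_neq0 //.
move: hC; rewrite ltr_pdivrMr // => hC.
have := mulr_gt0 ep Np; move: up3 hC; lra.
Qed.

Lemma seq_limitE u L : converges_to u L -> seq_limit u = L.
Proof.
move=> h; rewrite /seq_limit; case: excluded_middle_informative => [h'|]; last by case; exists L.
case: constructive_indefinite_description => M hM /=.
apply/eqP/negPn/negP => ne.
have d0 : 0 < `|M - L| / 2 by rewrite divr_gt0 // normr_gt0 subr_eq0.
have [N1 hN1] := h _ d0; have [N2 hN2] := hM _ d0.
have := hN1 (maxn N1 N2) (leq_maxl _ _); have := hN2 (maxn N1 N2) (leq_maxr _ _).
rewrite distrC => a b; have := ltrD a b.
rewrite -splitr => c; have := le_lt_trans (ler_normD _ _) c.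
by rewrite addrA subrK ltxx.
Qed.

Lemma scl_intE gs L : (forall g, g \in gs -> S g) -> is_scl gs L -> scl_int S gs = L%:E.
Proof.
move=> hgs hL; rewrite /scl_int; case: excluded_middle_informative => [h|]; last first.
  have [n [k [np h _]]] := proj2 hL 1 ltr01.
  case; exists n; split=> //.
  by have [m [-> _ _]] := clP (clpow_cl_le hgs h); rewrite ltry.
case: constructive_indefinite_description => k [kp hk] /=.
have [m hm] := cl_ltP hk.
rewrite (seq_limitE (cl_converges hgs hL kp (cl_le_clpow hgs hm))).
by rewrite mulrC mulKf // pnatr_eq0 -lt0n.
Qed.

Lemma scl_int_infty gs : (forall g, g \in gs -> S g) ->
  ~ (exists n k, (0 < n)%N /\ clpow gs n k) -> scl_int S gs = +oo%E.
Proof.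
move=> hgs h; rewrite /scl_int; case: excluded_middle_informative => // h'; case: h.
have [k [kp /cl_ltP [m hm]]] := h'.
by exists k, (size gs + m)%N; split=> //; apply: cl_le_clpow.
Qed.

Lemma in_commutator_subgroupP g :
  in_commutator_subgroup S g <-> exists k, comm_prod S k g.
Proof.
split=> [[ab [h ->]]|[k [ab [_ [h ->]]]]]; last by exists ab.
by exists (size ab), ab.
Qed.

(** All three branches of [scl_elt] are governed by one condition free of limits. An infinite value
    counts as positive, since then no bound [scl_lt] holds at all. *)
Lemma scl_elt_gt0 g : S g ->
  (0 < scl_elt S g)%E <-> exists2 e, 0 < e & ~ scl_lt [:: g] e.
Proof.
move=> hg.
have hgs : forall x, x \in [:: g] -> S x by move=> x; rewrite inE => /eqP ->.
have key k L : (0 < k)%N -> is_scl [:: g] L -> in_commutator_subgroup S (g ^+ k)%g ->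
    scl_comm S (g ^+ k)%g = k%:R * L.
  move=> kp hL /in_commutator_subgroupP[m hm].
  apply: seq_limitE.
  have -> : (fun n => fine (cl S [:: ((g ^+ k) ^+ n.+1)%g]) / n.+1%:R) =
            (fun n => fine (cl S (powseq [:: g] (k * n.+1))) / n.+1%:R).
    by apply: funext => n; rewrite /powseq /= expgnA.
  by apply: (@cl_converges _ _ _ m) => //; rewrite /clpow big_seq1.
have pos L : is_scl [:: g] L -> 0 < L <-> exists2 e, 0 < e & ~ scl_lt [:: g] e.
  move=> /is_scl_uniq hL; split=> [Lp|[e ep]].
    by exists L => //; rewrite hL ltxx.
  by rewrite hL => /negP; rewrite -leNgt; apply: lt_le_trans.
have ex k : (0 < k)%N -> in_commutator_subgroup S (g ^+ k)%g -> exists L, is_scl [:: g] L.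
  move=> kp /in_commutator_subgroupP[m hm]; apply: is_scl_exists.
  by exists k, m; split=> //; rewrite /clpow big_seq1.
rewrite /scl_elt; case: excluded_middle_informative => h1.
  have h1' : in_commutator_subgroup S (g ^+ 1)%g by rewrite expg1.
  have [L hL] := ex 1%N isT h1'.
  have := key 1%N L isT hL h1'; rewrite expg1 mul1r => ->.
  by rewrite lte_fin; exact: pos.
case: excluded_middle_informative => h2.
  case: constructive_indefinite_description => k [kp hk] /=.
  have [L hL] := ex k kp hk.
  rewrite (key k L) // mulrC mulKf ?pnatr_eq0 -?lt0n // lte_fin; exact: pos.
split=> [_|_]; last by rewrite ltry.
exists 1; first exact: ltr01.
move=> [n [k [np hk _]]]; apply: h2; exists n; split=> //.
by apply/in_commutator_subgroupP; exists k; move: hk; rewrite /clpow big_seq1.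
Qed.

End SclLimit.

(** * Isometry from an inequality on integral chains *)

Section Isometry.
Local Open Scope ring_scope.
Variable U : groupType.

(** The nontrivial inequality between the two [scl] on integral chains, infinite values included.
    Its hypothesis is witnessed by a single equation in [H], so the property composes along towers
    and passes to directed unions. *)
Definition scl_lt_reflecting (G H : U -> Prop) : Prop :=
  forall gs L, (forall g, g \in gs -> G g) -> scl_lt H gs L -> scl_lt G gs L.

Variables G H : U -> Prop.
Hypotheses (hG : is_subgroup G) (hH : is_subgroup H) (GH : forall x, G x -> H x).
Hypothesis refl : scl_lt_reflecting G H.

Lemma scl_lt_sub gs L : scl_lt G gs L -> scl_lt H gs L.
Proof. by move=> [n [k [np h lt]]]; exists n, k; split=> //; apply: comm_prod_mono h. Qed.

Lemma scl_int_eq gs : (forall g, g \in gs -> G g) -> scl_int H gs = scl_int G gs.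
Proof.
move=> hgs; have hgs' g : g \in gs -> H g by move=> /hgs /GH.
case: (pselect (exists n k, (0 < n)%N /\ clpow G gs n k)) => h.
  have [L hL] := is_scl_exists h.
  rewrite (scl_intE hG hgs hL); apply: scl_intE => //.
  have lt M : scl_lt H gs M <-> L < M.
    rewrite -(is_scl_uniq hL); split; [exact: refl | exact: scl_lt_sub].
  split=> [n k np hn|e ep]; last by rewrite lt ltrDl.
  rewrite leNgt; apply/negP => b.
  have := lt ((k + size gs)%:R / n%:R); rewrite ltr_pdivlMr ?ltr0n // => hlt.
  have [m [j [mp hj lt2]]] : scl_lt H gs L.
    exists n, k; split=> //.
  have /lt : scl_lt H gs L by exists m, j.
  by rewrite ltxx.
rewrite (scl_int_infty hG hgs h); apply: scl_int_infty => // -[n [k [np hn]]].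
(* Any bound above [(k + size gs) / n] would do; only finiteness is carried from [H] to [G]. *)
apply: h; have [|m [j [mp hj _]]] := @refl gs ((k + size gs).+1%:R) hgs.
  exists n, k; split=> //; rewrite -natrM ltr_nat.
  by rewrite -[X in (X < _)%N]muln1; apply: leq_trans (_ : _ <= (k + size gs).+1 * 1)%N _; rewrite ?leq_mul // !muln1.
by exists m, j.
Qed.

Lemma scl_rat_eq c : (forall p, p \in c -> G p.2) -> scl_rat H c = scl_rat G c.
Proof.
move=> hc; rewrite /scl_rat scl_int_eq // => g.
rewrite /int_chain_elems => /flattenP [s /mapP[p hp ->]] /nseqP [-> _].
have hp2 : G p.2 by move: hp; rewrite /rat_to_int_chain => /mapP[q /hc hq ->].
by case: ifP => _ //; apply: subV.
Qed.

(** The value at a real chain is built from [scl_rat] on coefficient lists over the same elements.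
    Once these functions are equal, so are the predicates behind the choice operators, and hence the
    chosen values. *)
Lemma isometric_of_scl_lt : scl_isometric G H.
Proof.
move=> c hc.
have e : (fun q => scl_rat H (zip q (map snd c))) = (fun q => scl_rat G (zip q (map snd c))).
  apply: funext => q; apply: scl_rat_eq => p hp.
  have : p.2 \in map snd c.
    elim: q (map snd c) hp => [|a q IH] [|b l] //=; rewrite inE => /predU1P[->|/IH].
      by rewrite mem_head.
    by rewrite inE orbC => ->.
  by move=> /mapP[x /hc hx ->].
have ra : rat_approx H c = rat_approx G c.
  apply: funext => q; apply: funext => d; rewrite /rat_approx.
  by have /(congr1 (fun f => f q)) /= -> := e.
have lim : scl_cont_limit H c = scl_cont_limit G c.
  apply: funext => L; rewrite /scl_cont_limit ra.
  by apply: (congr1 (fun f : seq rat -> _ => forall eps : RR, 0 < eps -> exists d : RR, 0 < d /\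
     forall q, rat_approx G c q d -> `|fine (f q) - L| < eps) e).
rewrite /scl ra lim; case: excluded_middle_informative => h //.
exact: (congr1 (fun f => f _) e).
Qed.

End Isometry.

(** * Consequences of the universal property *)

Record bijection (X : Type) := Bijection {
  bfun :> X -> X; binv : X -> X; bfunK : cancel bfun binv; binvK : cancel binv bfun }.

(** * Symmetric groups as targets of homomorphisms *)

Section SymmetricGroup.
Variable X : Type.
Implicit Types p q r : bijection X.

Lemma bijectionP p q : bfun p =1 bfun q -> p = q.
Proof.
case: p q => f f' fK f'K [g g' gK g'K] /= /funext e.
move: gK g'K; rewrite -{g}e => gK g'K.
have e' : f' = g' by apply: funext => x; rewrite -{2}(f'K x) gK.
move: gK g'K; rewrite -{g'}e' => gK g'K.
by congr Bijection; exact: Prop_irrelevance.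
Qed.

HB.instance Definition _ := gen_eqMixin (bijection X).
HB.instance Definition _ := gen_choiceMixin (bijection X).

Definition bij_one : bijection X := @Bijection X id id (fun=> erefl) (fun=> erefl).
Definition bij_inv p : bijection X := Bijection (@binvK X p) (@bfunK X p).
Definition bij_mul p q : bijection X :=
  Bijection (can_comp (@bfunK X p) (@bfunK X q)) (can_comp (@binvK X q) (@binvK X p)).

Lemma bij_mulA : associative bij_mul. Proof. by move=> p q r; apply: bijectionP. Qed.
Lemma bij_mul1 : left_id bij_one bij_mul. Proof. by move=> p; apply: bijectionP. Qed.
Lemma bij_mulr1 : right_id bij_one bij_mul. Proof. by move=> p; apply: bijectionP. Qed.
Lemma bij_mulV : left_inverse bij_one bij_inv bij_mul.
Proof. by move=> p; apply: bijectionP => x /=; rewrite bfunK. Qed.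
Lemma bij_mulrV : right_inverse bij_one bij_inv bij_mul.
Proof. by move=> p; apply: bijectionP => x /=; rewrite binvK. Qed.

HB.instance Definition _ :=
  isGroup.Build (bijection X) bij_mulA bij_mul1 bij_mulr1 bij_mulV bij_mulrV.

Lemma bij_mulE p q x : (p * q)%g x = p (q x). Proof. by []. Qed.

(** Total, with junk value [bij_one]: the universal property asks for maps defined on all of [U] and
    [rat], while the formulas used below are bijective only for arguments in a factor. *)
Definition to_bij (f : X -> X) : bijection X :=
  if pselect (exists p : bijection X, bfun p = f) is left h then sval (cid h) else bij_one.

Lemma to_bijE f g : cancel f g -> cancel g f -> to_bij f = f :> (X -> X).
Proof.
move=> h1 h2; rewrite /to_bij; case: pselect => [h|]; first exact: (svalP (cid h)).
by case; exists (Bijection h1 h2).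
Qed.

End SymmetricGroup.

(** * Homomorphisms out of one rational extension *)

Section Amalgam.
Variables (U : groupType) (G H : U -> Prop) (A : rat -> Prop) (Z : U -> Prop).
Variables (phi : U -> rat) (psi : rat -> U).
Hypotheses (hG : is_subgroup G) (hH : is_subgroup H) (am : amalgam_over G H A Z phi psi).

Lemma amalgam_hom (K : groupType) (f : U -> K) (g : rat -> K) :
  hom_on G f -> rat_hom_on A g -> (forall z, Z z -> f z = g (phi z)) ->
  exists h : U -> K,
    [/\ hom_on H h, forall x, G x -> h x = f x & forall a, A a -> h (psi a) = g a].
Proof.
move=> hf hg e; case: am => [_ [_ [_ [_ [_ [_ [_ [_ [_ [_ univ]]]]]]]]]].
by have [h [[h1 [h2 h3]] _]] := univ K f g hf hg e; exists h.
Qed.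

(* The swap of the two copies of [P] in [U * bool] commutes with the left
   translation by [x] exactly when [P x]; both actions of [H] agree on [G] and
   [A], so they are equal. *)
Lemma amalgam_generated (P : U -> Prop) : is_subgroup P ->
  (forall x, G x -> P x) -> (forall a, A a -> P (psi a)) -> forall x, H x -> P x.
Proof.
move=> hP GP AP.
case: am => [_ [_ [_ [_ [_ [_ [psiM [_ [psiK [_ univ]]]]]]]]]].
pose lm (x : U) (p : U * bool) := ((x * p.1)%g, p.2).
have lmK x : cancel (lm x) (lm x^-1%g) by move=> [u b]; rewrite /lm /= mulKg.
have lmVK x : cancel (lm x^-1%g) (lm x) by move=> [u b]; rewrite /lm /= mulVKg.
pose L x := to_bij (lm x).
have LE x p : L x p = lm x p by rewrite /L (to_bijE (lmK x) (lmVK x)).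
have LM x y : L (x * y)%g = (L x * L y)%g.
  by apply: bijectionP => p; rewrite bij_mulE !LE /lm /= mulgA.
pose sw (p : U * bool) := (p.1, if `[< P p.1 >] then ~~ p.2 else p.2).
have swK : cancel sw sw by move=> [u b]; rewrite /sw /=; case: asbool; rewrite ?negbK.
pose T := to_bij sw; have TE p : T p = sw p by rewrite /T (to_bijE swK swK).
have TT : (T * T = 1)%g by apply: bijectionP => p; rewrite bij_mulE !TE swK.
have LT x : P x -> (T * L x * T = L x)%g.
  move=> Px; apply: bijectionP => -[u b]; rewrite !bij_mulE TE LE TE /sw /lm /=.
  have -> : `[< P (x * u)%g >] = `[< P u >].
    apply: asbool_equiv_eq; split=> [h|]; last exact: subM.
    by rewrite -(mulKg x u); apply: subM => //; exact: subV.
  by case: asbool; rewrite ?negbK.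
have [h [_ uniq]] := univ (bijection (U * bool)) L (L \o psi) (fun x y _ _ => LM x y)
  (fun a b ha hb => etrans (congr1 L (psiM a b ha hb)) (LM _ _)) (fun z hz => congr1 L (esym (psiK z hz))).
move=> x Hx.
have e1 := uniq L (fun x y _ _ => LM x y) (fun _ _ => erefl) (fun _ _ => erefl) x Hx.
have e2 := uniq (fun x => T * L x * T)%g _ (fun y hy => LT y (GP y hy)) (fun a ha => LT _ (AP a ha)) x Hx.
have {e1}e2 : (T * L x * T = L x)%g.
  rewrite [RHS]e1; apply: e2 => y z _ _; rewrite LM !mulgA; congr (_ * _ * _)%g.
  by rewrite -[in RHS](mulgA _ T T) TT mulg1.
have := congr1 (fun q : bijection _ => bfun q (1%g, true)) e2.
rewrite !bij_mulE TE !LE TE /sw /lm /= mulg1.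
have -> : `[< P 1%g >] by apply/asboolP; exact: sub1.
by case: asboolP => // _ [].
Qed.

(** This encodes a homomorphism from [H] to the wreath product of [G] by [rat / La]: [s x] shifts
    the coordinates and [f x] lists the entries in [G]. Everything is lifted to [rat] and taken
    modulo [La], so no quotient is formed. *)
Definition monomial_cocycle (La : rat -> Prop) (s : U -> rat) (f : U -> rat -> U) : Prop :=
  [/\ is_rat_subgroup La,
      forall x y q, H x -> H y -> f (x * y)%g q = (f x (q + s y)%R * f y q)%g,
      forall x y, H x -> H y -> La (s (x * y)%g - (s x + s y))%R,
      forall x q l, H x -> La l -> f x (q + l)%R = f x q &
      forall x q, H x -> G (f x q)].

Lemma is_rat_subgroupB La a b : is_rat_subgroup La -> La a -> La b -> La (a - b)%R.
Proof. by move=> [_ [hD hN]] ha hb; apply: hD => //; apply: hN. Qed.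

Lemma phi1 : phi 1%g = 0%R.
Proof.
case: am => [_ [[Z1 _] [_ [phiM _]]]].
have := phiM _ _ Z1 Z1; rewrite mulg1 => /eqP.
by rewrite -subr_eq subrr eq_sym => /eqP.
Qed.

Lemma psi0 : psi 0%R = 1%g.
Proof.
case: am => [_ [[Z1 _] [_ [_ [_ [_ [_ [_ [psiK _]]]]]]]]].
by rewrite -phi1 psiK.
Qed.

Lemma rat_subgroup_image : is_rat_subgroup (fun q => exists2 z, Z z & q = phi z).
Proof.
case: am => [_ [hZ [_ [phiM _]]]].
split; first by exists 1%g; [exact: sub1 | rewrite phi1].
split=> [a b [x hx ->] [y hy ->]|a [x hx ->]].
  by exists (x * y)%g; [exact: subM | rewrite phiM].
exists x^-1%g; first exact: subV.
apply/esym/eqP; rewrite -addr_eq0 -phiM ?mulVg ?phi1 //; exact: subV.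
Qed.

(** For trivial [Z] the identity on [G] and the constant map on [A] are compatible; the image lies
    in [G] because [G] and [A] generate [H]. *)
Lemma trivial_edge_retraction : (forall z, Z z -> z = 1%g) ->
  exists f, [/\ hom_on H f, forall x, H x -> G (f x) & forall g, G g -> f g = g].
Proof.
move=> Z1.
have [h [hM hGf hA]] : exists h : U -> U,
    [/\ hom_on H h, forall x, G x -> h x = x & forall a, A a -> h (psi a) = 1%g].
  by apply: amalgam_hom; [by [] | by move=> a b _ _; rewrite mulg1 | exact: Z1].
exists h; split=> //.
have h1 : h 1%g = 1%g by apply: hGf; exact: sub1.
have hP : is_subgroup (fun x => H x /\ G (h x)).
  split; first by rewrite h1; split; exact: sub1.
  split=> [x y [Hx Gx] [Hy Gy]|x [Hx Gx]].
    by rewrite hM //; split; exact: subM.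
  have Hx' := subV hH Hx; split=> //.
  have -> : h x^-1%g = (h x)^-1%g by apply: (mulgI (h x)); rewrite -hM // !mulgV.
  exact: subV.
case: am => [_ [_ [_ [_ [_ [_ [_ [psiH [_ [GH _]]]]]]]]]].
move=> x; case/(amalgam_generated hP) => // [g hg|a ha]; split=> //.
- exact: GH.
- by rewrite hGf.
- exact: psiH.
- by rewrite hA //; exact: sub1.
Qed.

(* Induced representation: [H] acts on [(rat / phi Z) * U], with [G] acting
   diagonally and [A] by translation of the cosets twisted by [psi]; the cosets
   are represented by the fixed points of the idempotent map [r]. *)
Lemma amalgam_monomial : exists La s f,
  [/\ monomial_cocycle La s f,
      exists2 c, La c & (0 < c)%R &
      forall g q, G g -> La (s g) /\ f g q = g].
Proof.
case: (pselect (exists2 z, Z z & z <> 1%g)) => [[z0 hz0 z0n]|hZ1]; last first.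
  have [|f [fM fG fid]] := trivial_edge_retraction.
    by move=> z hz; apply: contrapT => zn; apply: hZ1; exists z.
  (* The wreath product degenerates to a single coordinate, given by the retraction. *)
  exists (fun=> True), (fun=> 0%R), (fun x _ => f x); split=> // [||g _ /fid //].
    by split=> // [x y q Hx Hy|x q Hx]; [exact: fM | exact: fG].
  by exists 1%R.
case: am => [[A0 [AD AN]] [hZ [ZG [phiM [phiA [phiI [psiM [psiH [psiK [GH _]]]]]]]]]].
pose La q := exists2 z, Z z & q = phi z.
have hLa : is_rat_subgroup La := rat_subgroup_image.
have LaA q : La q -> A q by move=> [z hz ->]; exact: phiA.
have [La0 [LaD LaN]] := hLa.
pose r (q : rat) : rat := xget 0%R [set q' | La (q' - q)%R].
have rP q : La (r q - q)%R.
  rewrite /r; case: xgetP => // /(_ q) []; rewrite /= subrr; exact: La0.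
have r_eq a b : La (a - b)%R -> r a = r b.
  move=> hab; rewrite /r; congr (xget _ _); apply/seteqP; split=> q /= hq.
    by rewrite -(subrKA a); apply: LaD.
  by rewrite -[(q - a)%R](subrKA b); apply: LaD => //; rewrite -opprB; apply: LaN.
have r_eqP a b : r a = r b -> La (a - b)%R.
  move=> e; have -> : (a - b = (r b - b) - (r a - a))%R by rewrite e; ring.
  exact: is_rat_subgroupB.
have rr q : r (r q) = r q by apply: r_eq.
have rrD q a : r (r q + a)%R = r (q + a)%R.
  by apply: r_eq; have -> : (r q + a - (q + a) = r q - q)%R by ring.
(* Monomial maps act on pairs whose first entry is a representative and fix all others, so that they
   are bijections of the full type. *)
pose mono (s : rat) (f : rat -> U) (p : rat * U) : rat * U := if r p.1 == p.1 then (r (p.1 + s)%R, f p.1 * p.2)%g else p.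
have monoE s f q u : mono s f (r q, u) = (r (q + s)%R, f (r q) * u)%g.
  by rewrite /mono /= rr eqxx rrD.
have monoN s f q u : r q <> q -> mono s f (q, u) = (q, u) by move=> /eqP h; rewrite /mono /= ifN.
have eqX (g1 g2 : rat * U -> rat * U) : (forall q u, g1 (r q, u) = g2 (r q, u)) ->
   (forall q u, r q <> q -> g1 (q, u) = g2 (q, u)) -> g1 =1 g2.
  move=> e1 e2 [q u]; case: (pselect (r q = q)) => [<-|]; [exact: e1 | exact: e2].
have monoM s1 f1 s2 f2 : mono s1 f1 \o mono s2 f2 =1
    mono (s2 + s1)%R (fun q => f1 (r (q + s2)%R) * f2 q)%g.
  apply: eqX => q u; first by rewrite /= !monoE !mulgA addrA rrD.
  by move=> h; rewrite /= !monoN.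
have mono0 s f : La s -> (forall q, f (r q) = 1%g) -> mono s f =1 id.
  move=> hs hf; apply: eqX => q u; last by move=> h; rewrite monoN.
  by rewrite monoE hf mul1g; congr pair; apply: r_eq; rewrite addrAC subrr add0r.
have monoK s f : cancel (mono s f) (mono (- s)%R (fun q => (f (r (q - s)%R))^-1)%g).
  move=> p; rewrite -[LHS]/((_ \o _) p) monoM mono0 ?subrr // => q.
  by rewrite rrD addrK rr mulVg.
have monoVK s f : cancel (mono (- s)%R (fun q => (f (r (q - s)%R))^-1)%g) (mono s f).
  move=> p; rewrite -[LHS]/((_ \o _) p) monoM mono0 ?addNr // => q.
  by rewrite mulgV.
pose B s f := to_bij (mono s f).
have BE s f p : B s f p = mono s f p by rewrite /B (to_bijE (monoK s f) (monoVK s f)).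
(* [G] fixes every coset. [A] translates them, and [psi] is applied to the element of [La] by which
   [q + a] differs from its representative; its value lies in [Z]. *)
pose bG g := B 0%R (fun=> g).
pose bA a := B a (fun q => psi (q + a - r (q + a))%R).
have La_r q : La (q - r q)%R by rewrite -opprB; apply: LaN.
have mono_ext s1 s2 f1 f2 : La (s1 - s2)%R -> (forall q, f1 (r q) = f2 (r q)) -> mono s1 f1 =1 mono s2 f2.
  move=> hs hf; apply: eqX => q u; last by move=> h; rewrite !monoN.
  rewrite !monoE hf; congr pair; apply: r_eq.
  by have -> : (q + s1 - (q + s2) = s1 - s2)%R by ring.
have [|||h [hM hG' hA']] := @amalgam_hom (bijection (rat * U)) bG bA.
- move=> x y _ _; apply: bijectionP => p; rewrite bij_mulE !BE -[RHS]/((_ \o _) p) monoM addr0.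
  by [].
- move=> a b ha hb; apply: bijectionP => p; rewrite bij_mulE !BE -[RHS]/((_ \o _) p) monoM.
  apply: mono_ext => [|q]; first by rewrite [(b + a)%R]addrC subrr.
  rewrite -psiM; last 2 first.
  + by apply: LaA.
  + by apply: LaA.
  rewrite !rrD -!addrA [(b + a)%R]addrC; congr psi; rewrite !addrA; ring.
- move=> z hz; apply: bijectionP => p; rewrite !BE; apply: mono_ext.
    by rewrite sub0r; apply: LaN; exists z.
  move=> q; have -> : r (r q + phi z)%R = r q.
    by rewrite rrD; apply: r_eq; rewrite addrAC subrr add0r; exists z.
  by rewrite addrAC subrr add0r psiK.
(* Acting monomially with entries in [G] is a subgroup condition; it holds on both factors, hence on
   all of [H]. *)
have hP : is_subgroup (fun x => H x /\ exists s f, (forall q, G (f q)) /\ h x =1 mono s f).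
  split; first (split; first exact: sub1).
    exists 0%R, (fun=> 1%g); split=> [_|p]; first exact: sub1.
    rewrite mono0 //; have -> : h 1%g = 1%g; last by [].
    by apply: (mulgI (h 1%g)); rewrite -hM ?mulg1 //; exact: sub1.
  split=> [x y [Hx [s [f [hf ex]]]] [Hy [t [g [hg ey]]]]|x [Hx [s [f [hf ex]]]]].
    split; first exact: subM.
    exists (t + s)%R, (fun q => f (r (q + t)%R) * g q)%g; split=> [q|p]; first exact: subM.
    by rewrite hM // bij_mulE ex ey -monoM.
  have Hx' := subV hH Hx; split=> //.
  exists (- s)%R, (fun q => (f (r (q - s)%R))^-1)%g; split=> [q|p]; first exact: subV.
  rewrite -[RHS](bfunK (h x)) ex monoVK.
  have -> : h x^-1%g = (h x)^-1%g; last by [].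
  apply: (mulgI (h x)); rewrite -hM // !mulgV.
  by apply: (mulgI (h 1%g)); rewrite -hM ?mulg1 //; exact: sub1.
have hmono x : exists sf, H x -> (forall q, G (sf.2 q)) /\ h x =1 mono sf.1 sf.2.
  case: (pselect (H x)) => [Hx|]; last by exists (0%R, fun=> 1%g).
  have [||_ [s [f e]]] := amalgam_generated hP _ _ Hx; last by exists (s, f).
  - move=> g hg; split; first exact: GH.
    by exists 0%R, (fun=> g); split=> // p; rewrite hG' // BE.
  - move=> a ha; split; first exact: psiH.
    exists a, (fun q => psi (q + a - r (q + a))%R); split=> [q|p]; last by rewrite hA' // BE.
    have [z hz ->] := La_r (q + a)%R; rewrite psiK //; exact: ZG.
have [sf hsf] := boolp.choice hmono.
(* Precomposition with [r] makes the entries periodic modulo [La]. *)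
exists La, (fun x => (sf x).1), (fun x q => (sf x).2 (r q)); split.
- have key x y q : H x -> H y -> (r (q + (sf (x * y)%g).1)%R, (sf (x * y)%g).2 (r q)) =
     (r (q + (sf y).1 + (sf x).1)%R, (sf x).2 (r (q + (sf y).1)%R) * (sf y).2 (r q))%g.
    move=> Hx Hy; have Hxy := subM hH Hx Hy.
    have := congr1 (fun b : bijection _ => b (r q, 1%g)) (hM _ _ Hx Hy).
    by rewrite bij_mulE (hsf _ Hxy).2 (hsf _ Hx).2 (hsf _ Hy).2 !monoE !mulg1.
  split=> // [x y q Hx Hy|x y Hx Hy|x q l Hx hl|x q Hx].
  + by have [] := key x y q Hx Hy.
  + have [/r_eqP e _] := key x y 0%R Hx Hy.
    by move: e; rewrite !add0r [(_.1 + (sf x).1)%R]addrC.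
  + by congr (_ _); apply: r_eq; rewrite addrAC subrr add0r.
  + exact: (hsf _ Hx).1.
- have ne : phi z0 <> 0%R.
    by rewrite -phi1 => /(phiI _ _ hz0 (sub1 hZ)).
  case: (ltrP 0%R (phi z0)) => hlt; first by exists (phi z0) => //; exists z0.
  exists (- phi z0)%R; first by apply: LaN; exists z0.
  by rewrite oppr_gt0 lt_neqAle hlt andbT; apply/eqP.
- move=> g q hg; have := hG' g hg; move/(congr1 (fun b : bijection _ => b (r q, 1%g))).
  rewrite (hsf _ (GH _ hg)).2 BE !monoE !mulg1 addr0 => -[/r_eqP e ->]; split=> //.
  by move: e; rewrite addrAC subrr add0r.
Qed.

(** The additive group [rat] enters as the group of its translations: [G] acts trivially, [A] by
    itself, and the translation length is read off at 0. *)
Lemma trivial_edge_hom : (forall z, Z z -> z = 1%g) ->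
  exists t : U -> rat,
    [/\ forall x y, H x -> H y -> t (x * y)%g = (t x + t y)%R,
        forall g, G g -> t g = 0%R & forall a, A a -> t (psi a) = a].
Proof.
move=> Z1.
pose T (a : rat) := to_bij (fun q : rat => q + a)%R.
have TE a q : T a q = (q + a)%R.
  by rewrite /T (@to_bijE _ _ (fun q => q - a)%R) // => x /=; rewrite ?addrK ?subrK.
have TM a b : T (a + b)%R = (T a * T b)%g.
  by apply: bijectionP => q; rewrite bij_mulE !TE addrAC addrA.
have T0 : T 0%R = 1%g by apply: bijectionP => q; rewrite TE addr0.
case: (am) => [_ [_ [_ [_ [_ [_ [_ [psiH [_ [GH _]]]]]]]]]].
have [|||h [hM hG1 hA]] := @amalgam_hom (bijection rat) (fun=> 1%g) T.
- by move=> x y _ _; rewrite mulg1.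
- by move=> a b _ _; exact: TM.
- by move=> z /Z1 ->; rewrite phi1 T0.
have h1 : h 1%g = 1%g by apply: hG1; exact: sub1.
have hV x : H x -> h x^-1%g = (h x)^-1%g.
  by move=> Hx; apply: (mulgI (h x)); rewrite -hM ?mulgV //; exact: subV.
have hP : is_subgroup (fun x => H x /\ exists a, h x = T a).
  split; first by split; [exact: sub1 | exists 0%R; rewrite h1 T0].
  split=> [x y [Hx [a ea]] [Hy [b eb]]|x [Hx [a ea]]].
    by split; [exact: subM | exists (a + b)%R; rewrite hM // ea eb TM].
  split; first exact: subV.
  by exists (- a)%R; rewrite hV // ea; apply: (mulgI (T a)); rewrite -TM subrr T0 mulgV.
exists (fun x => h x 0%R); split=> [x y Hx Hy|g hg|a ha].
- have [|| _ [a ea]] := amalgam_generated hP _ _ Hx.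
  + by move=> g hg; split; [exact: GH | exists 0%R; rewrite hG1 // T0].
  + by move=> a ha; split; [exact: psiH | exists a; rewrite hA].
  by rewrite hM // bij_mulE ea !TE add0r addrC.
- by rewrite hG1.
- by rewrite hA // TE add0r.
Qed.

End Amalgam.

(** * Transfer of commutator products *)

Section BalancedWords.
Local Open Scope group_scope.
Variables (U : groupType) (S : U -> Prop).
Hypothesis hS : is_subgroup S.
Implicit Types w : seq (U * bool).

(* A letter is a group element with a formal exponent [+1] or [-1]. *)
Definition letter (p : U * bool) : U := if p.2 then p.1 else p.1^-1.
Definition flip (p : U * bool) : U * bool := (p.1, ~~ p.2).
Definition balanced w : Prop :=
  forall u, count_mem (u, true) w = count_mem (u, false) w.

Lemma flipK : involutive flip. Proof. by move=> [u b]; rewrite /flip /= negbK. Qed.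

Lemma balanced_flip w p : balanced w -> count_mem p w = count_mem (flip p) w.
Proof. by move=> h; case: p => u [] /=; rewrite h. Qed.

Lemma balancedP w : (forall p, count_mem p w = count_mem (flip p) w) -> balanced w.
Proof. by move=> h u; rewrite h. Qed.

Lemma letter_flip p : letter (flip p) = (letter p)^-1.
Proof. by case: p => u []; rewrite /letter //= invgK. Qed.

Lemma flip_eq p q : (flip p == flip q) = (p == q).
Proof. by rewrite (inj_eq (inv_inj flipK)). Qed.

Lemma flip_eqL p q : (flip p == q) = (p == flip q).
Proof. by rewrite -{1}(flipK q) flip_eq. Qed.

(** Reduction of a polygon with glued edges. If the pair of [x] is linked with another pair, the
    word is [x A1 y A2 x^-1 B1 y^-1 B2]; splitting off one commutator removes four letters and
    leaves the balanced word [B1 A2 A1 B2]. Otherwise the parts [A] and [B] are balanced separately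
    and [x] merely conjugates the first. *)
Lemma comm_prod_balanced w : (forall p, p \in w -> S p.1) -> balanced w ->
  comm_prod S (size w %/ 4) (\prod_(p <- w) letter p).
Proof.
have [n] := ubnP (size w); elim: n w => // n IH [|x w] /=.
  by move=> _ _ _; rewrite big_nil; exact: comm_prod0.
rewrite ltnS => sz hw bal.
have Sl p : p \in x :: w -> S (letter p).
  by move=> /hw; rewrite /letter; case: ifP => // _; exact: subV.
have : flip x \in w.
  have := balanced_flip x bal; rewrite /= eqxx -has_pred1 has_count.
  have -> : (x == flip x) = false by case: (x) => u b; rewrite /flip -pair_eqE /= /pair_eq /= eqxx; case: b.
  by rewrite add0n => <-.
move=> /splitPr ew; case: ew sz hw bal Sl => A B sz hw bal Sl.
case: (boolP (has (fun y => flip y \in B) A)) => [/hasP[y yA yB]|noy].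
  case/splitPr: yA sz hw bal Sl => A1 A2; case/splitPr: yB => B1 B2 sz hw bal Sl.
  pose w2 := B1 ++ A2 ++ A1 ++ B2.
  have Sw2 p : p \in w2 -> p \in x :: (A1 ++ y :: A2) ++ flip x :: B1 ++ flip y :: B2.
    by rewrite /w2 !(mem_cat, inE) => /or4P[] ->; rewrite ?orbT.
  have szE : size (x :: (A1 ++ y :: A2) ++ flip x :: B1 ++ flip y :: B2) = (size w2 + 4)%N.
    by rewrite /w2 /= !size_cat /= !size_cat /=; lia.
  rewrite -/(size (x :: _)) szE.
  have -> : ((size w2 + 4) %/ 4 = (size w2 %/ 4).+1)%N by lia.
  pose v (l : seq (U * bool)) := \prod_(p <- l) letter p.
  have Sv (l : seq (U * bool)) :
      {subset l <= x :: (A1 ++ y :: A2) ++ flip x :: B1 ++ flip y :: B2} -> S (v l).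
    by move=> sl; apply: sub_prod => // p /sl; exact: Sl.
  pose c := v (B1 ++ A2 ++ A1).
  have -> : \prod_(p <- x :: (A1 ++ y :: A2) ++ flip x :: B1 ++ flip y :: B2) letter p =
      (c * commutator (c^-1 * (letter x * v A1)) (letter y * v (A2 ++ A1)) * c^-1) * v w2.
    rewrite /c /v /w2 /commutator.
    rewrite !(big_cat, big_cons) /= ?(big_cat, big_cons) /= !letter_flip.
    by grp.
  have Sc : S c.
    by apply: Sv => p; rewrite !(mem_cat, inE) => /or3P[] ->; rewrite ?orbT.
  rewrite -addn1 addnC; apply: comm_prodM.
    apply: comm_prodJ => //; apply: comm_prod_comm.
    + apply: subM => //; [exact: subV | apply: subM => //].
      * by apply: Sl; rewrite !(mem_cat, inE) eqxx.
      * by apply: Sv => p; rewrite !(mem_cat, inE) => ->; rewrite ?orbT.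
    + apply: subM => //.
      * by apply: Sl; rewrite !(mem_cat, inE) eqxx !orbT.
      * by apply: Sv => p; rewrite !(mem_cat, inE) => /orP[] ->; rewrite ?orbT.
  apply: IH.
  - by move: sz; rewrite /w2 !size_cat /= !size_cat /=; lia.
  - by move=> p /Sw2 /hw.
  apply: balancedP => p; have := balanced_flip p bal.
  rewrite /w2 /= !count_cat /= !count_cat /= !flip_eq !flip_eqL.
  by lia.
have balA : balanced A /\ balanced B.
  have key p : ~~ ((0 < count_mem p A)%N && (0 < count_mem (flip p) B)%N).
    rewrite -!has_count !has_pred1; apply: contra noy => /andP[pA pB].
    by apply/hasP; exists p.
  split; apply: balancedP => p; have := balanced_flip p bal; have := key p; have := key (flip p);
    by rewrite flipK /= !count_cat /= !flip_eq !flip_eqL; lia.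
rewrite big_cons big_cat big_cons /= letter_flip !mulgA.
apply: (@comm_prodW _ _ hS (size A %/ 4 + size B %/ 4)).
  by rewrite size_cat /=; lia.
have szA : (size A < n)%N by move: sz; rewrite size_cat /=; lia.
have szB : (size B < n)%N by move: sz; rewrite size_cat /=; lia.
apply: comm_prodM.
  apply: comm_prodJ => //; first by apply: Sl; rewrite mem_head.
  by apply: IH balA.1 => // p pA; apply: hw; rewrite !(mem_cat, inE) pA orbT.
by apply: IH balA.2 => // p pB; apply: hw; rewrite !(mem_cat, inE) pB !orbT.
Qed.

End BalancedWords.

Section Transfer.
Variables (U : groupType) (G H : U -> Prop).
Hypotheses (hG : is_subgroup G) (hH : is_subgroup H).
Variables (La : rat -> Prop) (s : U -> rat) (f : U -> rat -> U).
Hypothesis cocycle : monomial_cocycle G H La s f.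
Hypothesis pos_period : exists2 c, La c & (0 < c)%R.

Let La_sub : is_rat_subgroup La. Proof. by case: cocycle. Qed.
Let fM x y q : H x -> H y -> f (x * y)%g q = (f x (q + s y)%R * f y q)%g.
Proof. by case: cocycle => _ h _ _ _; apply: h. Qed.
Let sM x y : H x -> H y -> La (s (x * y)%g - (s x + s y))%R.
Proof. by case: cocycle => _ _ h _ _; apply: h. Qed.
Let fG x q : H x -> G (f x q).
Proof. by case: cocycle => _ _ _ _ h; apply: h. Qed.

Lemma cocycle_periodic x q q' : H x -> La (q - q')%R -> f x q = f x q'.
Proof.
case: cocycle => _ _ _ h _ Hx hq.
by rewrite -(h x q' _ Hx hq) addrC subrK.
Qed.

Lemma cocycle_s1 : La (s 1%g).
Proof.
have H1 := sub1 hH; have := sM H1 H1.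
rewrite mulg1 opprD addrA subrr sub0r => h.
by rewrite -[s _]opprK; case: La_sub => _ [_]; apply.
Qed.

Lemma cocycle_1 q : f 1%g q = 1%g.
Proof.
have H1 := sub1 hH; have := fM q H1 H1; rewrite mulg1.
rewrite (@cocycle_periodic _ (q + _)%R q) //; last by rewrite addrAC subrr add0r; exact: cocycle_s1.
by move/(congr1 (fun x => x * (f 1 q)^-1)%g); rewrite mulgK mulgV => <-.
Qed.

Lemma cocycle_sV x : H x -> La (s x + s x^-1%g)%R.
Proof.
move=> Hx; have := sM Hx (subV hH Hx); rewrite mulgV => h.
have -> : (s x + s x^-1%g = s 1%g - (s 1%g - (s x + s x^-1%g)))%R by ring.
by apply: is_rat_subgroupB => //; exact: cocycle_s1.
Qed.

Lemma cocycle_V x q : H x -> f x^-1%g q = (f x (q + s x^-1%g)%R)^-1%g.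
Proof.
move=> Hx; apply: (mulgI (f x (q + s x^-1%g)%R)).
by rewrite -fM ?mulgV ?cocycle_1 //; exact: subV.
Qed.

(** The coordinate of a commutator at [q], kept as letters. The two letters from the first entry of
    [ab] have opposite signs and arguments differing by the shift of the second entry, and vice
    versa; summed over a full period they balance. *)
Definition comm_word (ab : U * U) (q : rat) : seq (U * bool) :=
  let p := (q + s ab.2^-1%g + s ab.1^-1%g)%R in
  [:: (f ab.1 (p + s ab.2)%R, true); (f ab.2 p, true);
      (f ab.1 p, false); (f ab.2 (p + s ab.1)%R, false)].

Lemma cocycle_commutator ab q : H ab.1 -> H ab.2 ->
  f (commutator ab.1 ab.2) q = (\prod_(p <- comm_word ab q) letter p)%g.
Proof.
case: ab => a b /= Ha Hb; have Ha' := subV hH Ha; have Hb' := subV hH Hb.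
rewrite /commutator !fM //; try by do !apply: subM.
rewrite /comm_word /= !big_cons big_nil /letter /= mulg1 !mulgA !cocycle_V //.
congr (_ * _)%g; last congr (_^-1)%g.
apply: cocycle_periodic => //.
have -> : (q + s b^-1%g - (q + s b^-1%g + s a^-1%g + s a) = - (s a + s a^-1%g))%R by ring.
by case: La_sub => _ [_]; apply; exact: cocycle_sV.
Qed.

Lemma cocycle_s_commutator a b : H a -> H b -> La (s (commutator a b)).
Proof.
move=> Ha Hb; have Ha' := subV hH Ha; have Hb' := subV hH Hb.
have Hab := subM hH Ha Hb; have Haba := subM hH Hab Ha'.
have h1 := sM Haba Hb'; have h2 := sM Hab Ha'; have h3 := sM Ha Hb.
have h4 := cocycle_sV Ha; have h5 := cocycle_sV Hb.
have [_ [LaD _]] := La_sub.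
have h := LaD _ _ h1 (LaD _ _ h2 (LaD _ _ h3 (LaD _ _ h4 h5))).
by rewrite /commutator; apply: (eq_ind _ La h); ring.
Qed.

Lemma cocycle_comm_prod (ab : seq (U * U)) q : (forall p, p \in ab -> H p.1 /\ H p.2) ->
  let x := foldr (fun p acc => commutator p.1 p.2 * acc)%g 1%g ab in
  [/\ H x, La (s x) & f x q = (\prod_(p <- flatten [seq comm_word c q | c <- ab]) letter p)%g].
Proof.
elim: ab => [|c ab IH] hab /=.
  by rewrite big_nil; split; [exact: sub1 | exact: cocycle_s1 | exact: cocycle_1].
have [] := IH; first by move=> p hp; apply: hab; rewrite inE hp orbT.
set x := foldr _ _ _ => Hx sx fx; have [Hc1 Hc2] := hab c (mem_head _ _).
have Hc : H (commutator c.1 c.2).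
  by rewrite /commutator; do !apply: subM => //; exact: subV.
split; first exact: subM.
- have h1 := sM Hc Hx; have h2 := cocycle_s_commutator Hc1 Hc2.
  have [_ [LaD _]] := La_sub.
  by apply: (eq_ind _ La (LaD _ _ h1 (LaD _ _ h2 sx))); ring.
- rewrite fM // (@cocycle_periodic _ (q + _)%R q) //; last by rewrite addrAC subrr add0r.
  by rewrite fx cocycle_commutator // !big_cons big_nil mulg1 !mulgA.
Qed.

(** A shift by [d] rotates the [n] sample points cyclically modulo the period [n d]. *)
Lemma sum_periodic_shift (h : rat -> nat) (d : rat) (n : nat) (z : int) (t : rat) :
  (forall q, h (q + n%:R * d)%R = h q) ->
  \sum_(0 <= j < n) h (j%:R * d + (z%:~R * d + t))%R = \sum_(0 <= j < n) h (j%:R * d + t)%R.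
Proof.
move=> per.
have step u : \sum_(0 <= j < n) h (j%:R * d + (d + u))%R = \sum_(0 <= j < n) h (j%:R * d + u)%R.
  case: (n) per => [|m] per; first by rewrite !big_geq.
  rewrite big_nat_recr //= [RHS]big_nat_recl //= addnC; congr (_ + _).
    have -> : (m%:R * d + (d + u) = (0%:R * d + u) + m.+1%:R * d)%R by rewrite -natr1; ring.
    exact: per.
  by apply: eq_bigr => j _; rewrite -natr1; congr h; ring.
have nat_shift k u : \sum_(0 <= j < n) h (j%:R * d + (k%:R * d + u))%R = \sum_(0 <= j < n) h (j%:R * d + u)%R.
  elim: k u => [|k IH] u; first by apply: eq_bigr => j _; rewrite mul0r add0r.
  rewrite -[RHS]IH -[RHS]step; apply: eq_bigr => j _.
  by rewrite -natr1; congr h; ring.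
case: z => k; first exact: nat_shift.
rewrite -[LHS](nat_shift k.+1); apply: eq_bigr => j _.
by rewrite NegzE mulrNz; congr h; ring.
Qed.

Lemma common_denominator (l : seq rat) :
  exists2 D : nat, (0 < D)%N & forall q, q \in l -> exists z : int, (q = z%:~R / D%:R)%R.
Proof.
elim: l => [|a l [D Dp hD]]; first by exists 1%N.
have da : (`|denq a|%N%:R = (denq a)%:~R :> rat)%R.
  by rewrite -[RHS]/(_%:~R)%R -[in RHS](@gez0_abs (denq a)) ?denq_ge0.
have dn0 : (`|denq a|%N%:R != 0 :> rat)%R by rewrite da intr_eq0 denq_neq0.
have D0 : (D%:R != 0 :> rat)%R by rewrite pnatr_eq0 -lt0n.
exists (D * `|denq a|)%N; first by rewrite muln_gt0 Dp absz_gt0 denq_neq0.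
move=> q; rewrite inE => /predU1P[->|/hD[z ->]].
  exists (numq a * D%:Z)%R; rewrite intrM -{1}(divq_num_den a) -da natrM.
  by field; rewrite dn0 D0.
exists (z * `|denq a|%N%:Z)%R; rewrite intrM natrM; by field; rewrite dn0 D0.
Qed.

(* The coordinates of the cocycle along the cyclic group generated by a common
   denominator multiply up to a word in which every letter occurs as often as
   its inverse. *)
Lemma transfer_comm_prod x m : (forall q, f x q = x) -> comm_prod H m x ->
  exists2 n : nat, (0 < n)%N & comm_prod G (n * m) (x ^+ n)%g.
Proof.
move=> fx [ab [sz [hab ex]]].
have [c Lc c0] := pos_period.
have [D Dp hD] := common_denominator (c :: [seq s p.1 | p <- ab] ++ [seq s p.2 | p <- ab]).
have D0 : (D%:R != 0 :> rat)%R by rewrite pnatr_eq0 -lt0n.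
pose d : rat := (D%:R^-1)%R.
have [z ez] := hD c (mem_head _ _).
have zp : (0 < z)%R.
  by move: c0; rewrite ez pmulr_lgt0 ?invr_gt0 ?ltr0n // ltr0z.
(* The period [c] consists of [n] steps of length [d], and all shifts occurring in [ab] are integer
   multiples of [d]. *)
pose n := `|z|%N.
have nd : (n%:R * d = c)%R.
  by rewrite ez /d /n; congr (_ * _)%R; rewrite -[in RHS](@gtz0_abs z).
have np : (0 < n)%N by rewrite /n absz_gt0 gt_eqF.
exists n => //.
pose w := flatten [seq flatten [seq comm_word e (j%:R * d)%R | e <- ab] | j <- index_iota 0 n].
have szw : size w = (4 * (n * m))%N.
  rewrite /w size_flatten /shape -map_comp sumnE big_map.
  have -> : (4 * (n * m) = \sum_(0 <= j < n) (4 * m))%N.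
    by rewrite sum_nat_const_nat subn0 mulnCA.
  apply: eq_bigr => j _; rewrite /= size_flatten /shape -map_comp sumnE big_map /= big_const_seq count_predT sz.
  by elim: (m) => //= k ->; lia.
have wE : (x ^+ n = \prod_(p <- w) letter p)%g.
  rewrite /w big_flatten big_map -[n in LHS]subn0 -prodg_const_nat /=.
  apply: eq_bigr => j _; rewrite -(fx (j%:R * d)%R) ex.
  by have [_ _ ->] := cocycle_comm_prod (j%:R * d)%R hab.
rewrite wE; have -> : (n * m = size w %/ 4)%N by rewrite szw mulKn.
have Hab e : e \in ab -> H e.1 /\ H e.2 by exact: hab.
apply: comm_prod_balanced => //.
  move=> p /flattenP[_ /mapP[j _ ->]] /flattenP[_ /mapP[e /Hab [h1 h2] ->]].
  by rewrite !inE => /or4P[] /eqP ->; exact: fG.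
move=> u; rewrite /w !count_flatten -!map_comp !sumnE !big_map.
under eq_bigr do rewrite /= count_flatten -map_comp sumnE big_map.
under [RHS]eq_bigr do rewrite /= count_flatten -map_comp sumnE big_map.
(* After exchanging the sums, each commutator is balanced by itself. *)
rewrite exchange_big [RHS]exchange_big /=; apply: eq_big_seq => -[a b] hab'.
have [/= Ha Hb] := Hab _ hab'.
have [za eza] : exists za : int, (s a = za%:~R * d)%R.
  by apply: hD; rewrite inE mem_cat; apply/or3P; constructor 2; apply/mapP; exists (a, b).
have [zb ezb] : exists zb : int, (s b = zb%:~R * d)%R.
  by apply: hD; rewrite inE mem_cat; apply/or3P; constructor 3; apply/mapP; exists (a, b).
pose t := (s b^-1%g + s a^-1%g)%R.
have per y : H y -> forall q, (f y (q + n%:R * d)%R == u) = (f y q == u) :> nat.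
  move=> Hy q; congr (nat_of_bool (_ == u)); apply: cocycle_periodic => //.
  by rewrite addrAC subrr add0r nd.
have sa := @sum_periodic_shift (fun q => f a q == u) d n zb t (per a Ha).
have sb := @sum_periodic_shift (fun q => f b q == u) d n za t (per b Hb).
have eqs q : (q + (zb%:~R * d + t) = q + s b^-1%g + s a^-1%g + s b)%R by rewrite /t ezb; ring.
have eqs' q : (q + (za%:~R * d + t) = q + s b^-1%g + s a^-1%g + s a)%R by rewrite /t eza; ring.
have eqt q : (q + t = q + s b^-1%g + s a^-1%g)%R by rewrite /t; ring.
under eq_bigr do rewrite !xpair_eqE /= ?andbT ?andbF ?addn0 ?add0n.
under [RHS]eq_bigr do rewrite !xpair_eqE /= ?andbT ?andbF ?addn0 ?add0n.
rewrite !big_split /=.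
under eq_bigr do rewrite -eqs.
rewrite sa.
under [X in _ = _ + X]eq_bigr do rewrite -eqs'.
rewrite sb.
by congr (_ + _); apply: eq_bigr => j _; rewrite eqt.
Qed.

End Transfer.

Lemma extension_comm_prod (U : groupType) (G H : U -> Prop) x m :
  is_subgroup G -> is_subgroup H -> rational_extension G H -> G x ->
  comm_prod H m x -> exists2 n : nat, (0 < n)%N & comm_prod G (n * m) (x ^+ n)%g.
Proof.
move=> hG hH [A [Z [phi [psi am]]]] Gx.
have [La [s [f [coc per fGE]]]] := amalgam_monomial hG hH am.
by apply: (transfer_comm_prod hG hH coc per) => q; have [_] := fGE x q Gx.
Qed.

(** * Towers of extensions *)

Section Tower.
Local Open Scope ring_scope.
Variable U : groupType.

Lemma exists_natM_gt (c x : RR) : 0 < x -> exists2 M : nat, (0 < M)%N & c < M%:R * x.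
Proof.
move=> x0; exists (Num.trunc (c / x)).+1 => //.
by rewrite -ltr_pdivrMr //; exact: truncnS_gt.
Qed.

(** The transfer bounds a power of the product of the [g ^+ (M * n)], whereas [scl] concerns the
    product of powers. Passing between them costs [size gs] per unit of the transfer exponent [n'],
    which is negligible against [M]. *)
Lemma extension_reflecting (G H : U -> Prop) : is_subgroup G -> is_subgroup H ->
  (forall x, G x -> H x) -> rational_extension G H -> scl_lt_reflecting G H.
Proof.
move=> hG hH GH ext gs L hgs [n [k [np hk lt]]].
have hgs' g : g \in gs -> H g by move=> /hgs /GH.
set p := size gs in lt.
have gap : 0 < L * n%:R - (k + p)%:R by rewrite subr_gt0.
(* One [p] pays for exchanging power and product, the other for the summand [size gs] in
   [scl_lt]. *)
have [M Mp hM] := exists_natM_gt (2 * p)%:R gap.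
have hx := clpow_muln hH M hgs' hk.
have Gx : G (\prod_(g <- gs) g ^+ (M * n))%g.
  by apply: (sub_prod hG) => g hg; apply: (subX hG); exact: hgs.
have [n' n'p h'] := extension_comm_prod hG hH ext Gx hx.
have hpw : forall g, g \in powseq gs (M * n) -> G g.
  by move=> _ /mapP[g /hgs hg ->]; exact: (subX hG).
have hy := comm_prod_pow_prod hG hpw n'.
exists (M * n * n')%N, (n' * p + n' * (M * (k + p)))%N; split.
- by rewrite !muln_gt0 Mp np n'p.
- rewrite /clpow; under eq_bigr do rewrite expgnA.
  rewrite !big_map size_map in hy.
  exact: comm_prod_div hy h'.
- have n'p' : 1 <= n'%:R :> RR by rewrite ler1n.
  have a1 : n'%:R * (2 * p)%:R < n'%:R * (M%:R * (L * n%:R - (k + p)%:R)).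
    by rewrite ltr_pM2l // ltr0n.
  have a2 : p%:R <= n'%:R * p%:R :> RR by rewrite ler_peMl.
  move: a1 a2; rewrite -/p !natrD !natrM !natrD; lra.
Qed.

Lemma reflecting_trans (G1 G2 G3 : U -> Prop) : (forall x, G1 x -> G2 x) ->
  scl_lt_reflecting G1 G2 -> scl_lt_reflecting G2 G3 -> scl_lt_reflecting G1 G3.
Proof.
by move=> h12 r12 r23 gs L hgs h; apply: r12 => //; apply: r23 => // g /hgs /h12.
Qed.

Variables (I : Type) (lt : I -> I -> Prop) (S : I -> U -> Prop).
Variable (ext : (U -> Prop) -> (U -> Prop) -> Prop).
Hypothesis wo : well_order lt.
Hypothesis it : iterated_extension ext lt S.

Lemma tower_subgroup j : is_subgroup (S j). Proof. by case: it => h _; exact: h. Qed.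
Lemma tower_mono j k x : lt j k -> S j x -> S k x.
Proof. by case: it => _ [h _]; apply: h. Qed.

Lemma succ_or_limit j k : lt j k -> (exists i, is_succ lt i k) \/ is_limit lt k.
Proof.
move=> jk; case: (pselect (exists i, is_succ lt i k)) => h; [by left | right].
by split; [exists j |].
Qed.

Lemma succ_bound i j k : is_succ lt i k -> lt j k -> j = i \/ lt j i.
Proof.
move=> [ik hi] jk; have [irr [tr [tri _]]] := wo.
case: (tri j i) => [|[|ij]]; [by right | by left |].
case: (hi _ ij) => [e|kj]; first by case: (irr k); rewrite -{1}e.
by case: (irr k); exact: tr kj jk.
Qed.

Lemma limit_common b j (l : seq U) : is_limit lt b -> lt j b ->
  (forall x, x \in l -> S b x) ->
  exists i, [/\ lt i b, j = i \/ lt j i & forall x, x \in l -> S i x].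
Proof.
move=> lim jb; have [irr [tr [tri _]]] := wo.
elim: l => [|x l IH] hl; first by exists j; split=> //; left.
have [] := IH; first by move=> y hy; apply: hl; rewrite inE hy orbT.
move=> i [ib ji hi]; case: it => _ [_ [_ /(_ b lim x)[/(_ (hl x (mem_head _ _))) [i' [i'b Si']] _]]].
case: (tri i i') => [ii'|[e|i'i]].
- exists i'; split=> //; first by right; case: ji => [->|ji] //; exact: tr ji ii'.
  by move=> y; rewrite inE => /predU1P[->//|/hi]; exact: tower_mono.
- by exists i; split=> // y; rewrite inE => /predU1P[->|/hi//]; rewrite e.
- exists i; split=> // y; rewrite inE => /predU1P[->|/hi//].
  exact: tower_mono i'i Si'.
Qed.

Lemma limit_comm_prod b j x k : is_limit lt b -> lt j b -> comm_prod (S b) k x ->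
  exists i, [/\ lt i b, j = i \/ lt j i & comm_prod (S i) k x].
Proof.
move=> lim jb [ab [sz [hab e]]].
have [|i [ib ji hi]] := @limit_common b j (map fst ab ++ map snd ab) lim jb.
  by move=> y; rewrite mem_cat => /orP[] /mapP[p /hab[h1 h2] ->].
exists i; split=> //; exists ab; split=> //; split=> // p hp.
by split; apply: hi; rewrite mem_cat map_f // orbT.
Qed.

Hypothesis ext_rational : forall G H, ext G H -> rational_extension G H.

(** Well-founded induction on [k]: a successor adds one extension, and at a limit the finitely many
    elements of a witness already lie in an earlier stage not below [j]. *)
Lemma tower_reflecting j k : lt j k -> scl_lt_reflecting (S j) (S k).
Proof.
have [irr [tr [tri wf]]] := wo.
elim: (wf k) j => {}k _ IH j jk.
case: (succ_or_limit jk) => [[i ik]|lim].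
  have istep : scl_lt_reflecting (S i) (S k).
    apply: extension_reflecting; try exact: tower_subgroup.
      by move=> x; apply: tower_mono; case: ik.
    by apply: ext_rational; case: it => _ [_ [h _]]; apply: h.
  case: (succ_bound ik jk) => [->|ji] //.
  apply: reflecting_trans istep; first by move=> x; exact: tower_mono.
  by apply: IH => //; case: ik.
move=> gs L hgs [n [m [np hm lt']]].
have [i [ib ji hi]] := limit_comm_prod lim jk hm.
have ri : scl_lt (S i) gs L by exists n, m.
by case: ji => [->|ji] //; apply: (IH i) => //.
Qed.

End Tower.

(** * Normal forms *)

Section ReducedWords.
Variables (U : groupType) (G Q Z : U -> Prop).

Definition factor (b : bool) : U -> Prop := if b then G else Q.

Fixpoint reduced (b : bool) (l : seq U) : Prop :=
  if l is x :: l' then [/\ factor b x, ~ Z x & reduced (~~ b) l'] else True.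

End ReducedWords.

Section NormalForm.
Local Open Scope group_scope.
Variables (U : groupType) (G H : U -> Prop) (A : rat -> Prop) (Z : U -> Prop).
Variables (phi : U -> rat) (psi : rat -> U).
Hypotheses (hG : is_subgroup G) (hH : is_subgroup H) (am : amalgam_over G H A Z phi psi).

Definition amalgam_image : U -> Prop := fun x => exists2 a, A a & x = psi a.
Local Notation Q := amalgam_image.
Local Notation factor := (factor G Q).
Local Notation reduced := (reduced G Q Z).

Lemma amalgam_Z : is_subgroup Z. Proof. by case: am => _ []. Qed.
Lemma amalgam_ZG x : Z x -> G x. Proof. by case: am => _ [_ [h _]]; exact: h. Qed.
Lemma amalgam_GH x : G x -> H x.
Proof. by case: am => _ [_ [_ [_ [_ [_ [_ [_ [_ [h _]]]]]]]]]; exact: h. Qed.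
Lemma amalgam_ZQ x : Z x -> Q x.
Proof.
case: am => _ [_ [_ [_ [phiA [_ [_ [_ [psiK _]]]]]]]] hx.
by exists (phi x); [exact: phiA | rewrite psiK].
Qed.
Lemma amalgam_QH x : Q x -> H x.
Proof. by case: am => _ [_ [_ [_ [_ [_ [_ [h _]]]]]]] [a ha ->]; exact: h. Qed.

Lemma amalgam_Q : is_subgroup Q.
Proof.
case: (am) => [[A0 [AD AN]] [_ [_ [_ [_ [_ [psiM _]]]]]]].
split; first by exists 0%R => //; rewrite (psi0 am).
split=> [x y [a ha ->] [b hb ->]|x [a ha ->]].
  by exists (a + b)%R; [exact: AD | rewrite psiM].
exists (- a)%R; first exact: AN.
apply: (mulgI (psi a)); rewrite -psiM ?subrr ?mulgV ?(psi0 am) //; exact: AN.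
Qed.

Let hZ := amalgam_Z.
Let hQ := amalgam_Q.

Lemma factor_sub b : is_subgroup (factor b). Proof. by case: b. Qed.
Lemma factor_H b x : factor b x -> H x.
Proof. by case: b; [exact: amalgam_GH | exact: amalgam_QH]. Qed.
Lemma factor_Z b x : Z x -> factor b x.
Proof. by case: b; [exact: amalgam_ZG | exact: amalgam_ZQ]. Qed.

Lemma Z_mulL z x : Z z -> Z (z * x) <-> Z x.
Proof.
move=> hz; split=> h; last exact: subM.
by rewrite -(mulKg z x); apply: subM => //; exact: subV.
Qed.

(** A representative of the coset [Z x], chosen from the set itself so that it depends only on the
    coset; [Z] is represented by 1. *)
Let r (x : U) : U := if pselect (Z x) then 1 else xget 1 [set y | exists2 z, Z z & y = z * x]%classic.

Let rP x : exists2 z, Z z & r x = z * x.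
Proof.
rewrite /r; case: pselect => h; first by exists x^-1; [exact: subV | rewrite mulVg].
case: xgetP => [y _ [z hz ->]|/(_ x)[]]; first by exists z.
by exists 1; rewrite ?mul1g //; exact: sub1.
Qed.

Let r_mul z x : Z z -> r (z * x) = r x.
Proof.
move=> hz; rewrite /r; have [h1 h2] := Z_mulL x hz.
case: pselect => a; case: pselect => b //; try by case: b; auto.
  by case: a; auto.
have -> : [set y | exists2 z0, Z z0 & y = z0 * (z * x)]%classic = [set y | exists2 z0, Z z0 & y = z0 * x]%classic.
  apply/seteqP; split=> y /= [w hw ->].
    by exists (w * z); [exact: subM | rewrite mulgA].
  by exists (w * z^-1); [apply: subM => //; exact: subV | rewrite mulgA mulgVK].
by [].
Qed.

Let r_Z x : Z (x * (r x)^-1).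
Proof. by have [z hz ->] := rP x; rewrite invgM mulgA mulgV mul1g; exact: subV. Qed.

Let r_notZ x : ~ Z x -> ~ Z (r x).
Proof. by have [z hz ->] := rP x; rewrite Z_mulL. Qed.

Let r_factor b x : factor b x -> factor b (r x).
Proof.
have [z hz ->] := rP x => hx; apply: subM => //; first exact: factor_sub.
exact: factor_Z.
Qed.

Let r_idem x : r (r x) = r x.
Proof. by have [z hz e] := rP x; rewrite {1}e r_mul. Qed.

Let head_not b (l : seq (bool * U)) : bool := if l is p :: _ then p.1 != b else true.

Let Fixpoint normal (l : seq (bool * U)) : Prop :=
  if l is p :: l' then
    [/\ factor p.1 p.2, ~ Z p.2, r p.2 = p.2, head_not p.1 l' & normal l']
  else True.

(* The state [(z, l)] stands for [z] times the product of [l]; [unpack b] and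
   [pack b] merge [z] with a leading syllable from [factor b] and split it again,
   so that [factor b] acts by left multiplication in between. *)
Let state := (U * seq (bool * U))%type.
Let valid (s : state) : Prop := Z s.1 /\ normal s.2.
Let open_valid b (s : state) : Prop := [/\ factor b s.1, head_not b s.2 & normal s.2].

Let unpack b (s : state) : state :=
  if s.2 is p :: l then if p.1 == b then (s.1 * p.2, l) else s else s.
Let pack b (s : state) : state :=
  if pselect (Z s.1) then s else (s.1 * (r s.1)^-1, (b, r s.1) :: s.2).
Let act b g s : state := let s' := unpack b s in pack b (g * s'.1, s'.2).

Let unpack_valid b s : valid s -> open_valid b (unpack b s).
Proof.
case: s => z [|[c t] l] [/= hz].
  by move=> _; split=> //; exact: factor_Z.
move=> [h1 h2 h3 h4 h5]; rewrite /unpack /=; case: eqP => [<-|/eqP ne]; split=> //=.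
  by apply: subM => //; [exact: factor_sub | exact: factor_Z].
exact: factor_Z.
Qed.

Let pack_valid b s : open_valid b s -> valid (pack b s).
Proof.
case: s => x l [/= h1 h2 h3]; rewrite /pack /=; case: pselect => hx; split=> //=.
by split=> //; [exact: r_factor | exact: r_notZ].
Qed.

Let unpackK b s : valid s -> pack b (unpack b s) = s.
Proof.
case: s => z [|[c t] l] [/= hz]; rewrite /unpack /pack /=; first by case: pselect.
move=> [h1 h2 h3 h4 h5]; case: eqP => [<-|ne] /=; last by case: pselect.
case: pselect => [h|h] /=; first by case: h2; apply/(Z_mulL t hz).
by rewrite r_mul // h3 mulgK.
Qed.

Let packK b s : open_valid b s -> unpack b (pack b s) = s.
Proof.
case: s => x l [/= h1 h2 h3]; rewrite /unpack /pack /=; case: pselect => hx /=.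
  by case: l h2 {h3} => [|p l] //= /negbTE ->.
by rewrite eqxx mulgVK.
Qed.

Let open_validM b g s : factor b g -> open_valid b s -> open_valid b (g * s.1, s.2).
Proof. by move=> hg [h1 h2 h3]; split=> //=; apply: subM => //; exact: factor_sub. Qed.

Let act_valid b g s : factor b g -> valid s -> valid (act b g s).
Proof. by move=> hg hs; apply/pack_valid/open_validM => //; exact: unpack_valid. Qed.

Let actM b g g' s : factor b g -> factor b g' -> valid s ->
  act b (g * g') s = act b g (act b g' s).
Proof.
move=> hg hg' hs; rewrite /act packK ?mulgA //.
by apply: open_validM => //; exact: unpack_valid.
Qed.

Let act1 b s : valid s -> act b 1 s = s.
Proof. by move=> hs; rewrite /act mul1g -[RHS](unpackK b hs) -surjective_pairing. Qed.

(** For either factor, [z] just multiplies the first component. This is the compatibility needed to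
    glue the two actions. *)
Let act_Z z b b' s : Z z -> valid s -> act b z s = act b' z s.
Proof.
suff key c : Z z -> valid s -> act c z s = (z * s.1, s.2) by move=> h1 h2; rewrite !key.
move=> hz; case: s => z0 [|[c' t] l] [/= hz0]; rewrite /act /unpack /pack /=.
  by case: pselect => // -[]; exact: subM.
move=> [h1 h2 h3 h4 h5]; have hzz0 : Z (z * z0) by exact: subM.
case: eqP => [<-|ne] /=; case: pselect => //= h; rewrite mulgA in h *.
  by case: h2; apply/(Z_mulL t hzz0).
by rewrite r_mul ?h3 ?mulgK.
Qed.

Let Act b g s : state := if pselect (valid s) then act b g s else s.

Let ActK b g : factor b g -> cancel (Act b g) (Act b g^-1).
Proof.
move=> hg s; rewrite /Act; case: (pselect (valid s)) => hs; case: pselect => // hs'.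
  rewrite -actM // ?mulVg ?act1 //; exact: (subV (factor_sub b)).
by case: hs'; exact: act_valid.
Qed.

Let bij b g := to_bij (Act b g).

Let bijE b g s : factor b g -> bij b g s = Act b g s.
Proof.
move=> hg; rewrite /bij (to_bijE (ActK hg)) //.
by rewrite -{2}[g]invgK; apply: ActK; exact: (subV (factor_sub b)).
Qed.

Let bijM b g g' : factor b g -> factor b g' -> bij b (g * g') = bij b g * bij b g'.
Proof.
move=> hg hg'; apply: bijectionP => s; rewrite bij_mulE !bijE //; last first.
  exact: (subM (factor_sub b)).
rewrite /Act; case: pselect => hs; case: pselect => // hs'; first exact: actM.
by case: hs'; exact: act_valid.
Qed.

(** Van der Waerden's argument: [H] acts on normal forms, a reduced word moves the empty normal form
    to one with as many syllables as it has letters, and an element of [Z] moves it to one with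
    none. *)
Theorem reduced_notin_Z b l : reduced b l -> l <> [::] -> ~ Z (\prod_(x <- l) x).
Proof.
case: (am) => [_ [_ [_ [_ [_ [_ [psiM [_ [psiK _]]]]]]]]].
have [|||h [hM hGE hAE]] := @amalgam_hom _ _ _ _ _ _ _ am (bijection state) (bij true) (bij false \o psi).
- exact: (@bijM true).
- move=> a a' ha ha'; rewrite /= psiM // bijM //.
    by exists a.
  by exists a'.
- move=> z hz; apply: bijectionP => s; rewrite /= psiK // !bijE //; last first.
  + exact: amalgam_ZG.
  + exact: amalgam_ZQ.
  by rewrite /Act; case: pselect => // hs; exact: act_Z.
have hE c x s : factor c x -> h x s = Act c x s.
  case: c => hx; first by rewrite hGE // bijE.
  by case: (hx) => a ha ea; rewrite {1}ea hAE //= -ea bijE.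
have redH c m : reduced c m -> H (\prod_(x <- m) x).
  elim: m c => [|x m IH] c /=; first by rewrite big_nil => _; exact: sub1.
  move=> [hx _ /IH hm]; rewrite big_cons; apply: subM => //; exact: factor_H hx.
have h1 : h 1 = 1.
  by apply: (mulgI (h 1)); rewrite -hM ?mulg1 //; exact: sub1.
(* The middle clause ensures that the next letter, from the factor [~~ c], is not merged with the
   leading syllable. *)
have key c m : reduced c m -> let s := h (\prod_(x <- m) x) (1, [::]) in
    [/\ valid s, head_not (~~ c) s.2 & size s.2 = size m].
  elim: m c => [|x m IH] c /=.
    by rewrite big_nil h1 => _; split=> //; split=> //; exact: sub1.
  move=> [hx nx hm]; have Hm := redH _ _ hm.
  rewrite big_cons hM //; last exact: factor_H hx.
  rewrite bij_mulE; move: (IH _ hm) => /=.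
  case: (h (\prod_(x <- m) x) _) => z l' [hv hh hs].
  rewrite (hE c x) // /Act; case: pselect => //= hv0.
  have e : unpack c (z, l') = (z, l').
    by rewrite /unpack; case: (l') hh => //= p q; rewrite negbK => /negbTE ->.
  have hv' := act_valid hx hv.
  move: hv'; rewrite /act e /pack /=.
  case: pselect => [hxz|hxz hv'] /=.
    case: nx; have := subM hZ hxz (subV hZ hv.1). by rewrite mulgK.
  by split=> //; [case: (c) | rewrite -hs].
move=> hred ne hz.
have [] := key _ _ hred.
have Zv : valid (1, [::]) by split=> //; exact: sub1.
rewrite (hE true _ _ (amalgam_ZG hz)) /Act; case: (pselect (valid (1, [::]))) => hv0 /=; last by [].
have -> : act true (\prod_(x <- l) x) (1, [::]) = (\prod_(x <- l) x, [::]).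
  by rewrite /act /unpack /pack /= mulg1; case: pselect.
by move=> _ _ /=; case: (l) ne.
Qed.

End NormalForm.

(** * The counting quasimorphism *)

Section Words.
Local Open Scope group_scope.
Variables (U : groupType) (G Q Z : U -> Prop).
Hypotheses (hG : is_subgroup G) (hQ : is_subgroup Q) (hZ : is_subgroup Z).
Hypotheses (ZG : forall x, Z x -> G x) (ZQ : forall x, Z x -> Q x).
Local Notation factor := (factor G Q).
Local Notation reduced := (reduced G Q Z).
Local Notation pr l := (\prod_(x <- l) x).
Hypothesis notinZ : forall b l, reduced b l -> l <> [::] -> ~ Z (pr l).

Lemma factor_subgroup b : is_subgroup (factor b). Proof. by case: b. Qed.
Lemma Z_factor b x : Z x -> factor b x. Proof. by case: b; [exact: ZG | exact: ZQ]. Qed.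

Lemma Z_mull z x : Z z -> Z (z * x) -> Z x.
Proof. by move=> hz h; rewrite -(mulKg z x); apply: (subM hZ) => //; exact: (subV hZ). Qed.
Lemma Z_mulr z x : Z z -> Z (x * z) -> Z x.
Proof. by move=> hz h; rewrite -(mulgK z x); apply: (subM hZ) => //; exact: (subV hZ). Qed.

Lemma reduced_cat b l l' :
  reduced b (l ++ l') <-> reduced b l /\ reduced (b (+) odd (size l)) l'.
Proof.
elim: l b => [|x l IH] b /=; first by rewrite addbF; tauto.
by rewrite addbN -addNb; split=> [[h1 h2 /IH[h3 h4]]|[[h1 h2 h3] h4]]; split=> //; apply/IH.
Qed.

Lemma reduced_mulZ b z x l : Z z -> reduced b (x :: l) -> reduced b (z * x :: l).
Proof.
move=> hz [h1 h2 h3]; split=> //; last by move/(Z_mull hz).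
by apply: (subM (factor_subgroup b)) => //; exact: Z_factor.
Qed.

Lemma reduced_rcons_mulZ b z x l : Z z -> reduced b (rcons l x) -> reduced b (rcons l (x * z)).
Proof.
move=> hz; rewrite -!cats1 => /reduced_cat[h0 [h1 h2 _]]; apply/reduced_cat; split=> //.
split=> //; last by move/(Z_mulr hz).
by apply: (subM (factor_subgroup _)) => //; exact: Z_factor.
Qed.

Definition word_inv (l : seq U) : seq U := rev [seq x^-1 | x <- l].

Lemma word_inv_cons x l : word_inv (x :: l) = rcons (word_inv l) x^-1.
Proof. by rewrite /word_inv /= rev_cons. Qed.

Lemma size_word_inv l : size (word_inv l) = size l.
Proof. by rewrite /word_inv size_rev size_map. Qed.

Lemma word_inv_cat l l' : word_inv (l ++ l') = word_inv l' ++ word_inv l.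
Proof. by rewrite /word_inv map_cat rev_cat. Qed.

Lemma prod_word_inv l : pr (word_inv l) = (pr l)^-1.
Proof.
elim: l => [|x l IH]; first by rewrite !big_nil invg1.
by rewrite word_inv_cons big_rcons big_cons IH invgM.
Qed.

Lemma reduced_word_inv b l :
  reduced b l -> reduced (~~ (b (+) odd (size l))) (word_inv l).
Proof.
elim: l b => [|x l IH] b //= [h1 h2 /IH h3].
rewrite word_inv_cons -cats1; apply/reduced_cat; rewrite size_word_inv.
rewrite addbN -addNb; split=> //.
rewrite -addNb addbK negbK; split=> //; first exact: (subV (factor_subgroup b)).
by move/(subV hZ); rewrite invgK.
Qed.

(** If the first syllables differ in factor or modulo [Z], the inverse of [l'] followed by [l] gives
    a nonempty reduced word with product in [Z]. Otherwise [w] lies in [Z] and is passed on to the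
    tails. The last clause says that all prefixes agree up to [Z]. *)
Lemma reduced_uniq b b' l l' z z' : reduced b l -> reduced b' l' -> Z z -> Z z' ->
  pr l * z' = z * pr l' ->
  [/\ size l = size l', l <> [::] -> b = b' &
      forall i, exists2 c, Z c & pr (take i l) * c = z * pr (take i l')].
Proof.
elim: l b b' l' z z' => [|x l IH] b b' [|x' l'] z z'.
- by move=> _ _ hz hz' _; split=> // i; exists z; rewrite //= big_nil mul1g mulg1.
- move=> _ h hz hz'; rewrite big_nil mul1g => e.
  by case: (notinZ h) => //; apply: (Z_mull hz); rewrite -e.
- move=> h _ hz hz'; rewrite big_nil mulg1 => e.
  by case: (notinZ h) => //; apply: (Z_mulr hz'); rewrite e.
move=> h h' hz hz' e; have hzV := subV hZ hz.
have hi := reduced_word_inv h'.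
have bb' : b = b'.
  apply/eqP/negP => /negP ne.
  have red : reduced (~~ (b' (+) odd (size (x' :: l')))) (word_inv (x' :: l') ++ z^-1 * x :: l).
    apply/reduced_cat; split=> //; rewrite size_word_inv addNb addbK.
    have -> : ~~ b' = b by case: (b) (b') ne => [] [].
    exact: reduced_mulZ.
  case: (notinZ red); first by case: (word_inv _).
  have e2 : x * pr l = z * pr (x' :: l') * z'^-1 by rewrite -e big_cons mulgK.
  rewrite big_cat /= [X in _ * X]big_cons prod_word_inv /= -[z^-1 * x * _]mulgA e2.
  by move: (pr _) => P; grp; exact: (subV hZ).
subst b'; have [w wE] : exists w, w = x'^-1 * z^-1 * x by exists (x'^-1 * z^-1 * x).
have fw : factor b w.
  case: h h' => h _ _ [h' _ _]; rewrite wE; have fb := factor_subgroup b.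
  apply: (subM fb) => //; apply: (subM fb); first exact: (subV fb).
  exact: Z_factor.
have e1 : pr l' = w * pr l * z'.
  by move: e; rewrite !big_cons => /(congr1 (fun t => x'^-1 * (z^-1 * t))); rewrite !mulKg => <-; rewrite wE; grp.
have hw : Z w.
  apply: contrapT => nw.
  case: h' hi => [fx' nx' h'] _.
  have red : reduced (~~ (~~ b (+) odd (size l'))) (word_inv l' ++ w :: l).
    apply/reduced_cat; split; first exact: reduced_word_inv.
    rewrite size_word_inv addNb addbK negbK; split=> //.
    by case: h.
  case: (notinZ red); first by case: (word_inv _).
  rewrite big_cat /= [X in _ * X]big_cons prod_word_inv /= e1.
  by move: (pr l) => P; grp; exact: (subV hZ).
have hwV := subV hZ hw.
case: h h' => h1 h2 h3 [h1' h2' h3'].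
have e2 : pr l * z' = w^-1 * pr l' by rewrite e1 !mulgA mulVg mul1g.
have [hs _ ht] := IH _ _ _ _ _ h3 h3' hwV hz' e2.
split=> //=; first by rewrite hs.
case=> [|i]; first by exists z => //; rewrite !take0 !big_nil mul1g mulg1.
have [c hc ec] := ht i; exists c => //.
by rewrite /= !big_cons -mulgA ec wE; grp.
Qed.

(** * Counting occurrences of an element along reduced words *)

Section Windows.
Local Open Scope ring_scope.
Variables (v : U) (m : nat).
Hypothesis m_gt0 : (0 < m)%N.

(** Subwords of a reduced form are determined only up to [Z] on both sides, so an occurrence of [v]
    has to be taken modulo [Z]. *)
Definition double_coset (x : U) : Prop :=
  exists z z', [/\ Z z, Z z' & x = (z * v * z')%g].

Definition window_sign (x : U) : int :=
  `[< double_coset x >]%:R - `[< double_coset x^-1%g >]%:R.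

Lemma window_signV x : window_sign x^-1%g = - window_sign x.
Proof. by rewrite /window_sign invgK opprB. Qed.

Lemma double_cosetZ z z' x : Z z -> Z z' -> double_coset (z * x * z')%g <-> double_coset x.
Proof.
move=> hz hz'; split=> -[w [w' [hw hw' e]]].
  exists (z^-1 * w)%g, (w' * z'^-1)%g; split.
  - by apply: (subM hZ) => //; exact: (subV hZ).
  - by apply: (subM hZ) => //; exact: (subV hZ).
  - have -> : (z^-1 * w * v * (w' * z'^-1) = z^-1 * (w * v * w') * z'^-1)%g by grp.
    by rewrite -e; grp.
exists (z * w)%g, (w' * z')%g; split; try exact: (subM hZ).
by rewrite e; grp.
Qed.

Lemma window_signZ z z' x : Z z -> Z z' -> window_sign (z * x * z')%g = window_sign x.
Proof.
move=> hz hz'; rewrite /window_sign; congr (_%:R - _%:R).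
  by congr nat_of_bool; apply: asbool_equiv_eq; exact: double_cosetZ.
congr nat_of_bool; apply: asbool_equiv_eq.
have -> : (z * x * z')^-1%g = (z'^-1 * x^-1 * z^-1)%g by grp.
by apply: double_cosetZ; exact: (subV hZ).
Qed.

Lemma window_sign_le1 x : `|window_sign x| <= 1.
Proof. by rewrite /window_sign; case: asboolP; case: asboolP. Qed.

Definition window (l : seq U) (i : nat) : U := (\prod_(x <- take m (drop i l)) x)%g.
(** A counting function in the style of Brooks, with overlaps allowed. Truncated subtraction makes
    the sum empty for words shorter than [m]. *)
Definition count_windows (l : seq U) : int :=
  \sum_(i < (size l).+1 - m) window_sign (window l i).
Local Notation F := count_windows.

Lemma count_windows_nil : F [::] = 0.
Proof. by rewrite /F; case: (m) m_gt0 => // k _; rewrite subSS sub0n big_ord0. Qed.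

Lemma count_windows_cons x l :
  F (x :: l) = (if (m <= (size l).+1)%N then window_sign (window (x :: l) 0) else 0) + F l.
Proof.
rewrite /F /=; case: leqP => h; first by rewrite subSn // big_ord_recl.
have -> : ((size l).+2 - m = 0)%N by lia.
have -> : ((size l).+1 - m = 0)%N by lia.
by rewrite !big_ord0 addr0.
Qed.

(** A window is the quotient of two prefixes, and prefixes agree up to [Z] by [reduced_uniq]; so
    corresponding windows lie in the same double coset. *)
Lemma count_windows_eq b b' l l' z z' : reduced b l -> reduced b' l' -> Z z -> Z z' ->
  (pr l * z' = z * pr l')%g -> F l = F l'.
Proof.
move=> h h' hz hz' e; have [hs _ ht] := reduced_uniq h h' hz hz' e.
rewrite /F -hs; apply: eq_bigr => i _; rewrite /window.
have [c hc ec] := ht i; have [d hd ed] := ht (i + m)%N.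
have split_take (l0 : seq U) : (pr (take m (drop i l0)) = (pr (take i l0))^-1 * pr (take (i + m) l0))%g.
  by rewrite [take (i + m) l0]takeD [X in (_ * X)%g]big_cat /= mulKg.
rewrite !split_take.
have -> : pr (take i l) = (z * pr (take i l') * c^-1)%g by rewrite -ec mulgK.
have -> : pr (take (i + m) l) = (z * pr (take (i + m) l') * d^-1)%g by rewrite -ed mulgK.
rewrite -[RHS](@window_signZ c d^-1%g) //; last exact: (subV hZ).
by congr window_sign; grp.
Qed.

Lemma count_windows_inv l : F (word_inv l) = - F l.
Proof.
rewrite /F size_word_inv -sumrN (reindex_inj rev_ord_inj) /=; apply: eq_bigr => i _.
rewrite -window_signV -prod_word_inv; congr (window_sign (pr _)).
have hi := ltn_ord i; have hj : (i + m <= size l)%N by move: hi; lia.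
rewrite /word_inv map_take map_drop.
have : size [seq x^-1%g | x <- l] = size l by rewrite size_map.
move: [seq _ | _ <- _] => s es.
rewrite drop_rev take_rev es size_takel ?es ?leq_subr //.
have -> : (size l - ((size l).+1 - m - i.+1) = m + i)%N by lia.
by rewrite addKn take_drop.
Qed.

(** Only windows straddling the junction contribute. *)
Lemma count_windows_cat l l' : `|F (l ++ l') - F l - F l'| <= (minn (size l) m)%:R.
Proof.
elim: l => [|x l IH]; first by rewrite count_windows_nil subr0 subrr.
rewrite !count_windows_cons /= size_cat.
case: (boolP (m <= (size l).+1)%N) => h.
  have -> : (m <= (size l + size l').+1)%N by apply: leq_trans h _; rewrite ltnS leq_addr.
  have -> : window (x :: l ++ l') 0 = window (x :: l) 0.
    by rewrite /window !drop0 -cat_cons takel_cat.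
  set a := window_sign _; have -> : a + F (l ++ l') - (a + F l) - F l' = F (l ++ l') - F l - F l' by ring.
  by apply: le_trans IH _; rewrite ler_nat; lia.
rewrite add0r; have -> : minn (size l).+1 m = ((minn (size l) m) + 1)%N by move: h; lia.
set a := if _ then _ else _; have -> : a + F (l ++ l') - F l - F l' = (F (l ++ l') - F l - F l') + a by ring.
rewrite natrD; apply: le_trans (ler_normD _ _) _; apply: lerD => //.
by rewrite /a; case: ifP => _; [exact: window_sign_le1 | rewrite normr0].
Qed.

Lemma count_windows_cat_le l l' : `|F (l ++ l') - F l - F l'| <= m%:R.
Proof. by apply: le_trans (count_windows_cat l l') _; rewrite ler_nat geq_minr. Qed.

Lemma count_windows_cons_le x l : `|F (x :: l) - F l| <= 1.
Proof.
rewrite count_windows_cons addrK; case: ifP => _; [exact: window_sign_le1 | by rewrite normr0].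
Qed.

Lemma count_windows_drop j l : (j <= size l)%N ->
  (forall i, (i < j)%N -> (i + m <= size l)%N -> 0 <= window_sign (window l i)) ->
  F (drop j l) <= F l.
Proof.
elim: j l => [|j IH] [|x l] //= hj hw.
apply: le_trans (IH l hj _) _.
  by move=> i hi him; apply: (hw i.+1) => //; rewrite addSn.
rewrite count_windows_cons lerDr; case: ifP => h //; exact: hw.
Qed.

(** Syllables at the junction are cancelled as long as their product lies in [Z]. The process stops
    when a word is used up, when the next syllables come from different factors, or when they merge
    to a syllable outside [Z]. *)
Lemma cancellation b b' l l' z : reduced b l -> reduced b' l' -> Z z ->
  exists p q q' r z2,
    [/\ l = p ++ q, l' = q' ++ r, size q = size q', Z z2 & (pr q * z * pr q')%g = z2] /\
    [\/ p = [::], r = [::] | exists p1 x y r1, [/\ p = rcons p1 x, r = y :: r1 &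
      b (+) odd (size p1) <> b' (+) odd (size q') \/
      b (+) odd (size p1) = b' (+) odd (size q') /\ ~ Z (x * z2 * y)%g]].
Proof.
elim/last_ind: l b' l' z => [|l x IH] b' l' z.
  move=> _ _ hz; exists [::], [::], [::], l', z; split; last by constructor 1.
  by split=> //; rewrite !big_nil mulg1 mul1g.
case: l' => [|y l'] h h' hz.
  exists (rcons l x), [::], [::], [::], z; split; last by constructor 2.
  by split=> //; rewrite ?cats0 // !big_nil mulg1 mul1g.
case: (eqVneq (b (+) odd (size l)) b') => e; last first.
  exists (rcons l x), [::], [::], (y :: l'), z; split.
    by split=> //; rewrite ?cats0 // !big_nil mulg1 mul1g.
  constructor 3; exists l, x, y, l'; split=> //; left; rewrite addbF; exact/eqP.
case: (pselect (Z (x * z * y)%g)) => hw; last first.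
  exists (rcons l x), [::], [::], (y :: l'), z; split.
    by split=> //; rewrite ?cats0 // !big_nil mulg1 mul1g.
  by constructor 3; exists l, x, y, l'; split=> //; right; rewrite addbF.
move: h; rewrite -cats1 => /reduced_cat[h _]; case: h' => _ _ h'.
have [p [q [q' [r [z2 [[e1 e2 e3 e4 e5] e6]]]]]] := IH _ _ _ h h' hw.
exists p, (q ++ [:: x]), (y :: q'), r, z2; split.
  split=> //; rewrite ?e1 ?e2 ?catA //; first by rewrite size_cat addn1 e3.
  by rewrite big_cat !big_cons big_nil /= mulg1 -e5; grp.
case: e6 => [->|->|[p1 [x' [y' [r1 [e6 e7 e8]]]]]]; [by constructor 1 | by constructor 2 |].
constructor 3; exists p1, x', y', r1; split=> //.
by rewrite /= addbN -addNb.
Qed.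

Definition represents (l : seq U) (g : U) : Prop :=
  (exists b, reduced b l) /\ exists z z', [/\ Z z, Z z' & g = (z * pr l * z')%g].

Lemma represents_eq l l' g : represents l g -> represents l' g -> F l = F l'.
Proof.
move=> [[b h] [z [z' [hz hz' ->]]]] [[b' h'] [w [w' [hw hw' e]]]].
apply: (@count_windows_eq b b' l l' (z^-1 * w) (z' * w'^-1)) => //.
- by apply: (subM hZ) => //; exact: (subV hZ).
- by apply: (subM hZ) => //; exact: (subV hZ).
- have -> : (pr l * (z' * w'^-1) = z^-1 * (z * pr l * z') * w'^-1)%g by grp.
  by rewrite e; grp.
Qed.

(** Cutting each of two words into a surviving and a cancelled part costs [m]; reassembling the
    surviving parts costs at most [2 * m + 4]. *)
Let C : int := 4 * m%:R + 4.

(** The cancelled parts are inverse to each other up to [Z], so their counts cancel; what remains is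
    a bounded error at the junctions. *)
Lemma represents_mul l l' x y : represents l x -> represents l' y ->
  exists2 l'', represents l'' (x * y)%g & `|F l'' - F l - F l'| <= C.
Proof.
move=> [[b h] [a [a' [ha ha' ->]]]] [[b' h'] [c [c' [hc hc' ->]]]].
have hz : Z (a' * c)%g by exact: (subM hZ).
have [p [q [q' [r [z2 [[e1 e2 e3 hz2 e5] e6]]]]]] := cancellation h h' hz.
move: (h) (h'); rewrite e1 e2 => /reduced_cat[hp hq] /reduced_cat[hq' hr].
have -> : (a * pr (p ++ q) * a' * (c * pr (q' ++ r) * c') = a * (pr p * z2 * pr r) * c')%g.
  by rewrite -e5 !big_cat /=; grp.
have A1 := count_windows_cat_le p q; have A2 := count_windows_cat_le q' r.
have A3 : F q' = - F q.
  rewrite -count_windows_inv.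
  apply: (count_windows_eq hq' (reduced_word_inv hq) (subV hZ hz) (subV hZ hz2)).
  by rewrite prod_word_inv -e5; grp.
suff [l'' [z [z' [hred hz0 hz0' el bound]]]] : exists l'' z z',
    [/\ exists b, reduced b l'', Z z, Z z', (pr p * z2 * pr r = z * pr l'' * z')%g &
        `|F l'' - F p - F r| <= 2 * m%:R + 4].
  exists l''.
    split=> //; exists (a * z)%g, (z' * c')%g; split; try exact: (subM hZ).
    by rewrite el; grp.
  move: A1 A2 A3 bound; rewrite /C !ler_norml; lia.
have Z1 : Z 1%g := sub1 hZ.
case: e6 => [ep|er|[p1 [x' [y' [r1 [ep er e8]]]]]].
- exists r, z2, 1%g; split=> //; first by exists (b' (+) odd (size q')).
    by rewrite ep big_nil; grp.
  by rewrite ep count_windows_nil subr0 subrr normr0; lia.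
- exists p, 1%g, z2; split=> //; first by exists b.
    by rewrite er big_nil; grp.
  by rewrite er count_windows_nil subr0 subrr normr0; lia.
move: hp hr; rewrite ep er -cats1 => hp hr.
have [hp1 [fx nx _]] := (reduced_cat _ _ _).1 hp; have [fy ny hr1] := hr.
case: e8 => [ne|[e8 nz]].
  have hr' : reduced (b' (+) odd (size q')) (z2 * y' :: r1)%g by exact: reduced_mulZ.
  exists ((p1 ++ [:: x']) ++ (z2 * y' :: r1))%g, 1%g, 1%g; split=> //.
  - exists b; apply/reduced_cat; split=> //; rewrite size_cat addn1 /=.
    have -> : b (+) ~~ odd (size p1) = b' (+) odd (size q'); last by [].
    by move: ne; rewrite addbN; case: (_ (+) _) => [] ; case: (_ (+) _).
  - by rewrite !big_cat !big_cons /=; grp.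
  have <- : F (z2 * y' :: r1)%g = F (y' :: r1).
    by apply: (count_windows_eq hr' hr hz2 Z1); rewrite !big_cons; grp.
  by apply: le_trans (count_windows_cat_le _ _) _; lia.
exists (p1 ++ (x' * z2 * y') :: r1)%g, 1%g, 1%g; split=> //.
- exists b; apply/reduced_cat; split=> //; split=> //; last by rewrite e8.
  have fb := factor_subgroup (b (+) odd (size p1)).
  apply: (subM fb); last by rewrite e8.
  by apply: (subM fb) => //; exact: Z_factor.
- by rewrite !big_cat !big_cons big_nil /=; grp.
have B1 := count_windows_cat_le p1 (x' * z2 * y' :: r1)%g.
have B2 := count_windows_cons_le (x' * z2 * y')%g r1.
have B3 := count_windows_cons_le y' r1.
have B4 := count_windows_cat_le p1 [:: x'].
have B5 := count_windows_cons_le x' [::]; rewrite count_windows_nil subr0 in B5.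
by move: B1 B2 B3 B4 B5; rewrite !ler_norml; lra.
Qed.

Lemma represents_inv l g : represents l g -> represents (word_inv l) g^-1%g.
Proof.
move=> [[b h] [z [z' [hz hz' ->]]]]; split; first by eexists; exact: reduced_word_inv h.
exists z'^-1%g, z^-1%g; split; try exact: (subV hZ).
by rewrite prod_word_inv; grp.
Qed.

Definition generated (g : U) : Prop := exists l, represents l g.

Lemma represents_nil z : Z z -> represents [::] z.
Proof.
move=> hz; split; first by exists true.
by exists z, 1%g; split=> //; [exact: (sub1 hZ) | rewrite big_nil; grp].
Qed.

Lemma generated_factor b x : factor b x -> generated x.
Proof.
move=> hx; case: (pselect (Z x)) => hz; first by exists [::]; exact: represents_nil.
exists [:: x]; split; first by exists b.
by exists 1%g, 1%g; split; try exact: (sub1 hZ); rewrite big_seq1; grp.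
Qed.

Lemma generated_subgroup : is_subgroup generated.
Proof.
split; first by exists [::]; apply: represents_nil; exact: (sub1 hZ).
split=> [x y [l hx] [l' hy]|x [l hx]].
  by have [l'' h _] := represents_mul hx hy; exists l''.
by exists (word_inv l); exact: represents_inv.
Qed.

Definition counting (g : U) : int := F (xget [::] [set l | represents l g]%classic).

Lemma countingE l g : represents l g -> counting g = F l.
Proof.
move=> h; rewrite /counting; case: xgetP => [l' _ /= h'|/(_ l) //].
exact: represents_eq h' h.
Qed.

Lemma counting_quasi x y : generated x -> generated y ->
  `|counting (x * y)%g - counting x - counting y| <= C.
Proof.
move=> [l hx] [l' hy]; have [l'' h b] := represents_mul hx hy.
by rewrite (countingE hx) (countingE hy) (countingE h).
Qed.

Lemma countingV x : generated x -> counting x^-1%g = - counting x.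
Proof. by move=> [l hx]; rewrite (countingE hx) (countingE (represents_inv hx)) count_windows_inv. Qed.

(** Each commutator accounts for four multiplications with defect [C], while the values at inverse
    pairs cancel. *)
Lemma counting_comm_prod k x : comm_prod generated k x -> `|counting x| <= 4 * C * k%:R.
Proof.
have hgen := generated_subgroup.
elim: k x => [|k IH] x.
  move/comm_prod_0E ->; rewrite (countingE (represents_nil (sub1 hZ))) count_windows_nil.
  by rewrite normr0 mulr0.
move/comm_prodP => [a [b [y [ha hb hy ->]]]].
have gy := comm_prod_sub hgen hy; have {}IH := IH _ hy.
have ha' := subV hgen ha; have hb' := subV hgen hb.
have hab := subM hgen ha hb; have haba := subM hgen hab ha'.
have A1 := counting_quasi ha hb; have A2 := counting_quasi hab ha'.
have A3 := counting_quasi haba hb'.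
have A4 := counting_quasi (subM hgen haba hb') gy.
rewrite !countingV // in A2 A3.
have -> : 4 * C * k.+1%:R = 4 * C * k%:R + 4 * C by rewrite -natr1; ring.
move: IH A1 A2 A3 A4; rewrite /commutator !ler_norml.
move: (4 * C * k%:R) => K; lra.
Qed.

End Windows.
Lemma reduced_cat_mulZ b b' l l' z : reduced b l -> reduced b' l' -> l' <> [::] ->
  b (+) odd (size l) = b' -> Z z ->
  exists W, [/\ reduced b W, pr W = pr l * z * pr l' & size W = (size l + size l')%N].
Proof.
case: l' => // y l' h h' _ e hz; exists (l ++ z * y :: l'); split.
- by apply/reduced_cat; split=> //; rewrite e; exact: reduced_mulZ.
- by rewrite big_cat !big_cons /=; grp.
- by rewrite size_cat.
Qed.

(** * Consequences of malnormality *)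

Hypothesis mal : malnormal G Z.

Lemma malnormal_swap x c d : G x -> ~ Z x -> Z c -> Z d -> x * c = d * x -> d = 1.
Proof.
move=> hx nx hc hd e; apply: (mal hx nx hd); exists c; split=> //.
by rewrite e mulgK.
Qed.

(* The stabiliser of a path of length two through a [G]-vertex of the
   Bass-Serre tree is trivial. *)
Lemma acylindrical b l d d' : reduced b l -> (1 < size l)%N -> Z d -> Z d' ->
  d * pr l = pr l * d' -> d = 1.
Proof.
move=> h sz hd hd' e.
have [_ _ ht] := reduced_uniq h h hd hd' (esym e).
case: l h sz e ht => [|x [|y l]] // [fx nx [fy ny _]] _ _ ht.
have [c1 hc1] := ht 1%N; have [c2 hc2] := ht 2%N.
rewrite /= take0 !big_cons !big_nil !mulg1 => e2 e1.
(* Malnormality applies at the syllable from [G]. If that is the second one, triviality is carried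
   back across the first. *)
case: b fx fy => fx fy; first exact: malnormal_swap fx nx hc1 hd e1.
have c1E : c1 = 1.
  apply: (malnormal_swap fy ny hc2 hc1); apply: (mulgI x).
  by rewrite !mulgA e2 e1 mulgA.
by apply: (mulIg x); rewrite -e1 c1E mulg1 mul1g.
Qed.

(** The surviving parts of the two copies have equal length. They are both empty, or their ends come
    from the same factor and merge outside [Z], which leaves a reduced word still starting in factor
    [b]. *)
Lemma odd_word_square b l z : reduced b l -> odd (size l) -> Z z ->
  Z (pr l * z * pr l) \/
  exists l' z', [/\ reduced b l', l' <> [::], Z z' & pr l * z * pr l = pr l' * z'].
Proof.
move=> h hodd hz.
have [p [q [q' [r [z2 [[e1 e2 e3 hz2 e5] e6]]]]]] := cancellation h h hz.
have szpr : size p = size r.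
  by have := congr1 size e1; rewrite {1}e2 !size_cat e3; lia.
have e7 : pr l * z * pr l = pr p * z2 * pr r.
  by rewrite {1}e1 e2 -e5 !big_cat /=; grp.
case: e6 => [ep|er|[p1 [x [y [r1 [ep er e8]]]]]].
- left; rewrite e7; move: szpr; rewrite ep => /esym/size0nil ->.
  by rewrite big_nil mul1g mulg1.
- left; rewrite e7; move: szpr; rewrite er => /size0nil ->.
  by rewrite big_nil mul1g mulg1.
have par : odd (size p1) = odd (size q').
  have := congr1 size e1; rewrite ep size_cat size_rcons e3 => sl.
  by move: hodd; rewrite sl oddD /=; case: (odd _); case: (odd _).
case: e8 => [[]|[_ nz]]; first by rewrite par.
right; exists (p1 ++ (x * z2 * y) :: r1), 1; split; last 1 first.
- by rewrite e7 ep er -cats1 !big_cat !big_cons big_nil /=; grp.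
- move: (h) (h); rewrite {1}e1 e2 => /reduced_cat[hp _] /reduced_cat[_ hr].
  move: hp hr; rewrite ep er -cats1 => /reduced_cat[hp1 [fx _ _]] [fy ny hr1].
  apply/reduced_cat; split=> //; split=> //; last by rewrite par.
  have fb := factor_subgroup (b (+) odd (size p1)).
  apply: (subM fb); last by rewrite par.
  by apply: (subM fb) => //; exact: Z_factor.
- by case: (p1).
- exact: (sub1 hZ).
Qed.

Hypothesis torsion_free : forall q, generated q -> q * q = 1 -> q = 1.

Lemma generated_sub : is_subgroup generated.
Proof. exact: (@generated_subgroup 1 1%N). Qed.

Lemma reduced_generated b l : reduced b l -> generated (pr l).
Proof.
move=> h; exists l; split; first by exists b.
by exists 1, 1; split; try exact: (sub1 hZ); grp.
Qed.

(* An element [u z] inverting the cyclically reduced [h = u u'] would fix a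
   point of the axis of [h]; its square fixes the axis, hence is trivial. *)
Lemma not_conj_inverse b u u' z : reduced b (u ++ u') -> u' <> [::] ->
  ~~ odd (size (u ++ u')) -> Z z ->
  (pr u' * pr u)^-1 <> z * (pr u * pr u') * z^-1.
Proof.
move=> h u'n0 even hz e.
have e1 : pr u * z * pr u = (pr u')^-1 * z * (pr u')^-1.
  have : (pr u' * pr u)^-1 * z = z * (pr u * pr u') by rewrite e mulgVK.
  rewrite invgM => /(congr1 (fun t => pr u * t * (pr u')^-1)).
  by rewrite !mulgA mulgV mul1g mulgK => ->.
have /reduced_cat[hu hu'] := h.
have hi := reduced_word_inv hu'.
have parity : odd (size u) = odd (size u') by move: even; rewrite size_cat oddD; case: odd; case: odd.
have bE : ~~ (b (+) odd (size u) (+) odd (size u')) = ~~ b by rewrite parity addbK.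
rewrite {}bE in hi; rewrite -prod_word_inv in e1.
have Z1 := sub1 hZ.
have hui : word_inv u' <> [::].
  by move/(congr1 size); rewrite size_word_inv => /size0nil.
(* For odd [size u], both sides of [e1] lie in [Z], as otherwise they would be, up to [Z], reduced
   words starting in different factors. Then [q] inverts the product of [u ++ u'], so [q * q]
   commutes with it. *)
case ou: (odd (size u)).
  have ou' : odd (size (word_inv u')) by rewrite size_word_inv -parity.
  have sq : Z (pr u * z * pr u).
    case: (odd_word_square hu ou hz) => // -[l [c [hl ln hc el]]].
    case: (odd_word_square hi ou' hz) => [hZ'|[l' [c' [hl' ln' hc' el']]]]; first by rewrite e1.
    have e2 : pr l * (c * c'^-1) = 1 * pr l'.
      by rewrite mulgA -el e1 el' mulgK mul1g.
    have [_ bb _] := reduced_uniq hl hl' Z1 (subM hZ hc (subV hZ hc')) e2.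
    by have := bb ln; case: (b).
  pose q := pr u * z.
  have hq2 : Z (q * q) by rewrite /q !mulgA; exact: (subM hZ).
  have qh : q * (pr u * pr u') = (pr u * pr u')^-1 * q.
    rewrite /q; have : z * (pr u * pr u') = (pr u' * pr u)^-1 * z by rewrite e mulgVK.
    by rewrite -mulgA => ->; grp.
  have qhV : q * (pr u * pr u')^-1 = pr u * pr u' * q.
    by apply: (mulIg (pr u * pr u')); rewrite mulgVK -mulgA qh mulgA mulgV mul1g.
  have comm : (q * q) * pr (u ++ u') = pr (u ++ u') * (q * q).
    by rewrite big_cat /= -[LHS]mulgA qh mulgA qhV -mulgA.
  have sz1 : (1 < size (u ++ u'))%N.
    by move: even ou; rewrite size_cat; case: (u) => // x [|y l] //=; case: (u') u'n0.
  have q2 := acylindrical h sz1 hq2 hq2 comm.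
  have gq : generated q.
    apply: (subM generated_sub); first exact: reduced_generated hu.
    by exists [::]; exact: represents_nil.
  have q1 := torsion_free gq q2.
  case: (notinZ hu); first by move=> u0; rewrite u0 in ou.
  by rewrite -(mulgK z (pr u)) -/q q1 mul1g; exact: (subV hZ).
(* For even [size u] nothing cancels in [e1]: its sides are the reduced words [V] and [W] starting
   in different factors, or the left side is in [Z] when [u] is empty. *)
have ei : ~~ b (+) odd (size (word_inv u')) = ~~ b.
  by rewrite size_word_inv -parity ou addbF.
have [W [hW eW sW]] := reduced_cat_mulZ hi hi hui ei hz.
have Wn : (0 < size W)%N by rewrite sW; case: (word_inv u') hui.
case: (eqVneq u [::]) => [u0|un].
  have e2 : pr [::] * z = 1 * pr W by rewrite eW -e1 u0 big_nil; grp.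
  have [s0 _ _] := @reduced_uniq true (~~ b) [::] W 1 z I hW Z1 hz e2.
  by rewrite -s0 in Wn.
have eu : b (+) odd (size u) = b by rewrite ou addbF.
have [V [hV eV sV]] := reduced_cat_mulZ hu hu (elimN eqP un) eu hz.
have e2 : pr V * 1 = 1 * pr W by rewrite eV eW e1; grp.
have [sz bb _] := reduced_uniq hV hW Z1 Z1 e2.
have Vn : V <> [::] by move=> V0; move: Wn; rewrite -sz V0.
by have := bb Vn; case: (b).
Qed.

(** * Powers of a cyclically reduced word of even length *)

Section Hyperbolic.
Variables (b : bool) (w : seq U).
Hypotheses (hw : reduced b w) (w_neq0 : w <> [::]) (w_even : ~~ odd (size w)).
Local Notation h := (pr w).
Local Notation N := (size w).
Local Notation m := (2 * size w)%N.

Let N_gt0 : (0 < N)%N. Proof. by case: (w) w_neq0. Qed.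
Let N_gt1 : (1 < N)%N. Proof. by move: w_even N_gt0; case: (size w) => [|[|n]]. Qed.

Let reduced_pow n : reduced b (flatten (nseq n w)).
Proof.
elim: n => //= n IH; apply/reduced_cat; split=> //.
by rewrite (negbTE w_even) addbF.
Qed.

Let prod_pow n : pr (flatten (nseq n w)) = h ^+ n.
Proof. by elim: n => [|n IH] /=; rewrite ?big_nil // big_cat /= IH expgS. Qed.

(** Here [s] is a rotation of [h]. Comparing first periods gives [s^-1 = z * h * c^-1] with [c] in
    [Z]; the second period and acylindricity force [c = z], so an element of [Z] conjugates [h] to
    the inverse of its rotation, which [not_conj_inverse] excludes. *)
Lemma window_not_inverse i : (i < N)%N ->
  let s := pr (drop i w) * pr (take i w) in ~ double_coset (h * h) (s * s)^-1.
Proof.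
move=> hi s [z [z' [hz hz' e]]].
pose u := take i w; pose u' := drop i w.
have wE : w = u ++ u' by rewrite cat_take_drop.
have u'n0 : u' <> [::].
  by move/(congr1 size); rewrite size_drop => /eqP; rewrite subn_eq0 leqNgt hi.
have red : exists c, reduced c ((u' ++ u) ++ (u' ++ u)).
  have := reduced_pow 3; rewrite /= cats0 {1}wE -catA => /reduced_cat[_].
  have -> : u' ++ w ++ w = ((u' ++ u) ++ (u' ++ u)) ++ u' by rewrite wE !catA.
  by move/reduced_cat => [hh _]; eexists; exact: hh.
have [c0 /reduced_word_inv hred] := red; rewrite word_inv_cat in hred.
have hww : reduced b (w ++ w) by have := reduced_pow 2; rewrite /= cats0.
have sE : pr (word_inv (u' ++ u)) = s^-1 by rewrite prod_word_inv big_cat.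
have e1 : pr (word_inv (u' ++ u) ++ word_inv (u' ++ u)) * z'^-1 = z * pr (w ++ w).
  by rewrite !big_cat /= sE -invgM e mulgK.
have [_ _ ht] := reduced_uniq hred hww hz (subV hZ hz') e1.
have [c hc] := ht N.
rewrite take_size_cat; last by rewrite size_word_inv size_cat addnC -size_cat -wE.
rewrite take_size_cat //.
rewrite sE => e2.
have sV : s^-1 = z * h * c^-1 by rewrite -e2 mulgK.
have e3 : (c^-1 * z) * h = h * (z' * c).
  have : (z * h)^-1 * (s * s)^-1 * c = (z * h)^-1 * (z * (h * h) * z') * c by rewrite e.
  by rewrite (invgM s s) sV; grp.
have dZ : Z (c^-1 * z) by apply: (subM hZ) => //; exact: (subV hZ).
have d1 := acylindrical hw N_gt1 dZ (subM hZ hz' hc) e3.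
have cz : c = z by apply: (mulgI c^-1); rewrite d1 mulVg.
have hwE : reduced b (u ++ u') by rewrite -wE.
apply: (not_conj_inverse hwE u'n0 _ hz); first by rewrite -wE.
by rewrite -[pr u' * pr u]/s sV cz; congr (_ * _ * _); rewrite {1}wE big_cat.
Qed.

Let window_pow n i : (i < N)%N -> (i + m <= size (flatten (nseq n w)))%N ->
  window m (flatten (nseq n w)) i = (pr (drop i w) * pr (take i w)) * (pr (drop i w) * pr (take i w)).
Proof.
move=> hi; rewrite size_flatten /shape map_nseq sumn_nseq => hn.
case: n hn => [|[|n]] hn; try by move: hn N_gt0; lia.
have hE : h = pr (take i w) * pr (drop i w) by rewrite -[X in pr X = _](cat_take_drop i) big_cat.
rewrite /window /= drop_cat hi take_cat size_drop.
have -> : (m < N - i)%N = false by lia.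
have -> : (m - (N - i) = N + i)%N by lia.
rewrite takeD take_size_cat // drop_size_cat // !big_cat /= hE.
have -> : take i (flatten (nseq n w)) = take i w.
  case: (n) hn => [|k] hn; last by rewrite /= takel_cat // ltnW.
  by (have -> : i = 0%N by move: hn N_gt0; lia); rewrite !take0.
by rewrite !mulgA.
Qed.

Local Open Scope ring_scope.
Local Notation F := (count_windows (h * h)%g m).

(** Removing the first period loses the windows starting in it: none is negative, and the one at 0
    counts 1. A single period is too short for any window. *)
Lemma count_windows_pow n : n%:R <= F (flatten (nseq n.+1 w)).
Proof.
elim: n => [|n IH].
  by rewrite /count_windows /= cats0 (_ : (_ - _)%N = 0%N) ?big_ord0 //; move: N_gt0; lia.
have hmul : (m <= size (flatten (nseq n.+2 w)))%N.
  by rewrite size_flatten /shape map_nseq sumn_nseq; lia.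
have sign i : (i < N)%N -> (i + m <= size (flatten (nseq n.+2 w)))%N ->
    0 <= window_sign (h * h)%g (window m (flatten (nseq n.+2 w)) i).
  move=> hi him; rewrite window_pow // /window_sign.
  by rewrite (asboolF (window_not_inverse hi)) subr0.
have sign0 : window_sign (h * h)%g (window m (flatten (nseq n.+2 w)) 0) = 1.
  rewrite window_pow // take0 drop0 big_nil mulg1 /window_sign.
  have := window_not_inverse N_gt0; rewrite /= take0 drop0 big_nil mulg1 => /asboolF ->.
  rewrite subr0 asboolT //; exists 1%g, 1%g; split; try exact: (sub1 hZ).
  by grp.
move: hmul sign sign0; rewrite (_ : flatten (nseq n.+2 w) = w ++ flatten (nseq n.+1 w)) //.
move: IH.
move: (flatten (nseq n.+1 w)) => W; case: (w) N_gt0 => [//|x w' _].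
set k := (2 * _)%N => IH hmul sign sign0.
rewrite cat_cons in hmul sign sign0 *.
have k_gt0 : (0 < k)%N by [].
rewrite (count_windows_cons _ k_gt0) sign0 hmul -natr1 addrC lerD2l.
apply: le_trans IH _.
have e : drop (size w') (w' ++ W) = W by rewrite drop_size_cat.
rewrite -{1}e.
apply: count_windows_drop => //; first by rewrite size_cat leq_addr.
move=> i hi him; have := sign i.+1; rewrite /window /= => hs.
by apply: hs => //; rewrite addSn.
Qed.

Lemma hyperbolic_comm_prod n k : comm_prod generated k (h ^+ n.+1)%g ->
  n%:R <= 4 * (4 * m%:R + 4) * k%:R :> int.
Proof.
have m_gt0 : (0 < m)%N by move: N_gt0; lia.
move=> hk; have := counting_comm_prod (h * h)%g m_gt0 hk.
rewrite (@countingE _ _ (flatten (nseq n.+1 w))).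
  by rewrite ler_norml => /andP[_ hle]; apply: le_trans hle; exact: count_windows_pow.
split; first by exists b; exact: reduced_pow.
exists 1%g, 1%g; split; try exact: (sub1 hZ).
by rewrite prod_pow; grp.
Qed.

End Hyperbolic.

(** An even word absorbs [z] into its last syllable. In an odd word the end syllables share a
    factor; conjugating by the first merges them, which gives an even word or, if the result is in
    [Z], a word shorter by two. A single syllable gives the first two cases. *)
Lemma cyclically_reduced g : generated g -> exists2 t, generated t &
  [\/ G (t * g * t^-1), Q (t * g * t^-1) |
      exists b w, [/\ reduced b w, w <> [::], ~~ odd (size w) & t * g * t^-1 = pr w]].
Proof.
move=> [l [[b h] [z0 [z1 [hz0 hz1 ->]]]]].
suff key : forall n l b z, (size l <= n)%N -> reduced b l -> Z z -> exists2 t, generated t &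
  [\/ G (t * (pr l * z) * t^-1), Q (t * (pr l * z) * t^-1) |
      exists b w, [/\ reduced b w, w <> [::], ~~ odd (size w) & t * (pr l * z) * t^-1 = pr w]].
  have [t gt ht] := key _ l b (z1 * z0) (leqnn _) h (subM hZ hz1 hz0).
  exists (t * z0^-1).
    apply: (subM generated_sub) => //; exists [::]; apply: represents_nil; exact: (subV hZ).
  suff -> : t * z0^-1 * (z0 * pr l * z1) * (t * z0^-1)^-1 = t * (pr l * (z1 * z0)) * t^-1 by [].
  by grp.
have gen1 : generated 1 by exact: (sub1 generated_sub).
elim=> [|n IH] {z0 z1 hz0 hz1 h} {}l {}b z.
  rewrite leqn0 size_eq0 => /eqP-> _ hz; exists 1 => //; constructor 1.
  by rewrite big_nil; grp; exact: ZG.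
case: (boolP (odd (size l))) => [ol sl h hz|el sl h hz]; last first.
  case: (lastP l) el h {sl} => [_ _|{}l y el h].
    by exists 1 => //; constructor 1; rewrite big_nil; grp; exact: ZG.
  exists 1 => //; constructor 3; exists b, (rcons l (y * z)); split.
  - exact: reduced_rcons_mulZ.
  - by case: (l).
  - by move: el; rewrite !size_rcons.
  - by rewrite -!cats1 !big_cat /= !big_seq1; grp.
case: l ol sl h => // x l; case: (lastP l) => [_ _ [fx _ _]|{}l y].
  exists 1 => //; rewrite big_seq1; grp.
  have : factor b (x * z) by apply: (subM (factor_subgroup b)) => //; exact: Z_factor.
  by case: (b) => hxz; [constructor 1 | constructor 2].
rewrite /= size_rcons /= negbK => ol sl [fx nx].
rewrite -cats1 => /reduced_cat[hl [fy ny _]].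
have fyx : factor b (y * z * x).
  have fb := factor_subgroup b; have by' : ~~ b (+) odd (size l) = b by rewrite ol addbT negbK.
  rewrite by' in fy; apply: (subM fb) => //; apply: (subM fb) => //; exact: Z_factor.
have gx : generated x^-1 by apply: (subV generated_sub); exact: generated_factor fx.
have eg : x^-1 * (pr (x :: l ++ [:: y]) * z) * x = pr l * (y * z * x).
  by rewrite big_cons big_cat big_seq1 /=; grp.
case: (pselect (Z (y * z * x))) => hyx.
  have [|t gt ht] := IH l (~~ b) _ _ hl hyx; first by apply: ltnW; move: sl; lia.
  exists (t * x^-1); first exact: (subM generated_sub).
  suff -> : t * x^-1 * (pr (x :: l ++ [:: y]) * z) * (t * x^-1)^-1 = t * (pr l * (y * z * x)) * t^-1 by [].
  by rewrite -eg; grp.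
exists x^-1 => //; constructor 3; exists (~~ b), (l ++ [:: y * z * x]); split.
- by apply/reduced_cat; split=> //; rewrite ol addbT negbK.
- by case: (l).
- by rewrite size_cat addn1 /= ol.
- by rewrite invgK eg big_cat big_seq1.
Qed.

End Words.

(** * Positivity of scl *)

Section Positivity.
Local Open Scope ring_scope.
Variable U : groupType.

(** The form of positivity matching [scl_elt_gt0], with infinite values allowed. *)
Definition scl_positive (S : U -> Prop) : Prop :=
  forall g, S g -> g <> 1%g -> exists2 e, 0 < e & ~ scl_lt S [:: g] e.

Section Subgroup.
Variable S : U -> Prop.
Hypothesis hS : is_subgroup S.

Lemma clpow1 g n k : clpow S [:: g] n k <-> comm_prod S k (g ^+ n)%g.
Proof. by rewrite /clpow big_seq1. Qed.

Lemma expg_conj (g t : U) n : ((t * g * t^-1) ^+ n = t * g ^+ n * t^-1)%g.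
Proof.
elim: n => [|n IH]; first by rewrite !expg0 mulg1 mulgV.
by rewrite expgS IH (expgS g); grp.
Qed.

Lemma scl_lt_conj g t e : S t -> scl_lt S [:: g] e -> scl_lt S [:: (t * g * t^-1)%g] e.
Proof.
move=> ht [n [k [np /clpow1 h lt]]]; exists n, k; split=> //.
by apply/clpow1; rewrite expg_conj; exact: comm_prodJ.
Qed.

Lemma scl_lt_pow g n e : (0 < n)%N -> scl_lt S [:: g] e -> scl_lt S [:: (g ^+ n)%g] (n%:R * e).
Proof.
move=> np [j [k [jp /clpow1 h lt]]]; exists j, (n * k)%N; split=> //.
  by apply/clpow1; rewrite expgnAC; exact: comm_prodX.
rewrite /= in lt *; have n1 : 1 <= n%:R :> RR by rewrite ler1n.
have : n%:R * (k + 1)%:R < n%:R * (e * j%:R) by rewrite ltr_pM2l // ltr0n.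
by rewrite !natrD natrM; lra.
Qed.

Lemma positive_torsion_free g : scl_positive S -> S g -> (g * g = 1)%g -> g = 1%g.
Proof.
move=> pos hg g2; apply: contrapT => ne; have [e ep []] := pos g hg ne.
(* Even powers of [g] are trivial, so at exponent [2 * M] only the summand [size [:: g]] has to be
   beaten. *)
have [M Mp hM] := exists_natM_gt 1 ep.
exists (2 * M)%N, 0%N; split; first by rewrite muln_gt0.
  by apply/clpow1; rewrite expgnA expg2 g2 expg1n; exact: comm_prod0.
by rewrite /= add0n natrM; lra.
Qed.

End Subgroup.

Variables (G H : U -> Prop) (A : rat -> Prop) (Z : U -> Prop).
Variables (phi : U -> rat) (psi : rat -> U).
Hypotheses (hG : is_subgroup G) (hH : is_subgroup H) (am : amalgam_over G H A Z phi psi).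
Local Notation Q := (amalgam_image A psi).

Lemma amalgam_psiX a n : A a -> A (a *+ n) /\ psi (a *+ n) = (psi a ^+ n)%g.
Proof.
case: (am) => [[A0 [AD AN]] [_ [_ [_ [_ [_ [psiM _]]]]]]] ha.
elim: n => [|n [An e]]; first by rewrite mulr0n (psi0 am).
by rewrite mulrS expgS psiM // e; split=> //; exact: AD.
Qed.

Lemma amalgam_phiX z n : Z z -> phi (z ^+ n)%g = phi z *+ n.
Proof.
have hZ := amalgam_Z am; case: (am) => [_ [_ [_ [phiM _]]]] hz.
elim: n => [|n IH]; first by rewrite mulr0n (phi1 am).
by rewrite expgS phiM ?IH ?mulrS //; exact: (subX hZ).
Qed.

(** Nonzero rationals are commensurable: after possibly inverting [z], the ratio [a / phi z] is a
    positive fraction [j / n], whence [psi a ^+ n = z ^+ j]. *)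
Lemma amalgam_pow_in_G a : A a -> a <> 0 -> (exists2 z, Z z & z <> 1%g) ->
  exists n, [/\ (0 < n)%N, G (psi a ^+ n)%g & (psi a ^+ n)%g <> 1%g].
Proof.
move=> ha a0 [z0 hz0 nz0]; have hZ := amalgam_Z am.
case: (am) => [_ [_ [ZG [phiM [_ [phiI [_ [_ [psiK _]]]]]]]]].
have phi_neq0 z : Z z -> z <> 1%g -> phi z != 0.
  move=> hz nz; apply/eqP => pz; apply: nz; apply: phiI => //; first exact: (sub1 hZ).
  by rewrite pz (phi1 am).
have [z [hz zn rho]] : exists z, [/\ Z z, z <> 1%g & 0 < a / phi z].
  have ne : a / phi z0 != 0 by rewrite mulf_neq0 ?invr_eq0 ?phi_neq0 //; exact/eqP.
  case: (ltrP 0 (a / phi z0)) => h; first by exists z0.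
  have pV : phi z0^-1%g = - phi z0.
    by apply/eqP; rewrite -addr_eq0 -phiM ?mulVg ?(phi1 am) //; exact: (subV hZ).
  exists z0^-1%g; split; first exact: (subV hZ).
    by move=> e; apply: nz0; rewrite -(invgK z0) e invg1.
  by rewrite pV invrN mulrN oppr_gt0 lt_neqAle ne h.
have pz := phi_neq0 z hz zn.
pose r := a / phi z; pose n := `|denq r|%N; pose j := `|numq r|%N.
have np : (0 < n)%N by rewrite absz_gt0 denq_neq0.
have jp : (0 < j)%N by rewrite absz_gt0 numq_eq0 gt_eqF.
have e : a *+ n = phi z *+ j.
  have nE : n%:R = (denq r)%:~R :> rat by rewrite -[in RHS](@gtz0_abs (denq r)).
  have jE : j%:R = (numq r)%:~R :> rat by rewrite -[in RHS](@gtz0_abs (numq r)) // numq_gt0.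
  rewrite -[LHS]mulr_natr -[RHS]mulr_natl nE jE.
  have rE : a = r * phi z by rewrite /r divfK.
  by rewrite {1}rE -{1}(divq_num_den r); field; rewrite intr_eq0 denq_neq0.
have [_ eX] := amalgam_psiX n ha.
have zX : (psi a ^+ n = z ^+ j)%g.
  by rewrite -eX e -amalgam_phiX // psiK //; exact: (subX hZ).
exists n; rewrite zX; split=> //; first by apply: ZG; exact: (subX hZ).
move/(congr1 phi); rewrite amalgam_phiX // (phi1 am) => /eqP.
by rewrite mulrn_eq0 (negbTE pz) orbF; case: (j) jp.
Qed.

(** The homomorphism to [rat] from [trivial_edge_hom] kills commutators but takes the nonzero value
    [a *+ n] here. *)
Lemma amalgam_trivial_pow a n k : (forall z, Z z -> z = 1%g) -> A a -> a <> 0 -> (0 < n)%N ->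
  ~ comm_prod H k (psi a ^+ n)%g.
Proof.
move=> Z1 ha a0 np; have [t [tM _ tA]] := trivial_edge_hom hG hH am Z1.
have t1 : t 1%g = 0.
  by have := tA 0; rewrite (psi0 am); apply; case: am => [[]].
have tV x : H x -> t x^-1%g = - t x.
  by move=> Hx; apply/eqP; rewrite -addr_eq0 -tM ?mulVg ?t1 //; exact: (subV hH).
have key x l : comm_prod H l x -> t x = 0.
  elim: l x => [|l IH] x; first by move/comm_prod_0E ->.
  move/comm_prodP => [c [d [y [hc hd hy ->]]]].
  have hc' := subV hH hc; have hd' := subV hH hd.
  have Hy := comm_prod_sub hH hy; have h2 := subM hH hc hd; have h3 := subM hH h2 hc'.
  rewrite /commutator !tM ?tV ?(IH y hy) //; try exact: (subM hH).
  by ring.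
move/key; have [An <-] := amalgam_psiX n ha; rewrite tA // => /eqP.
by rewrite mulrn_eq0; case: (n) np => //= m _ /eqP.
Qed.

Hypothesis mal : malnormal G Z.
Hypothesis posG : scl_positive G.

Lemma amalgam_positive : scl_positive H.
Proof.
have hZ := amalgam_Z am; have hQ := amalgam_Q am.
have ZG := amalgam_ZG am; have ZQ := amalgam_ZQ am.
have GH := amalgam_GH am; have QH := amalgam_QH am.
have nz := reduced_notin_Z hG hH am.
have ratext : rational_extension G H by exists A, Z, phi, psi.
have refl := extension_reflecting hG hH GH ratext.
have hgen := generated_sub hG hQ hZ ZG ZQ nz.
have H_gen x : H x -> generated G Q Z x.
  apply: (amalgam_generated am hgen) => [g hg|a ha].
    exact: (generated_factor hZ (b := true)).
  by apply: (generated_factor hZ (b := false)); exists a.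
have gen_H x : generated G Q Z x -> H x.
  move=> [l [[b red] [z [z' [hz hz' ->]]]]].
  have lH : H (\prod_(y <- l) y)%g.
    elim: l b red => [|y l IH] b /=; first by rewrite big_nil => _; exact: (sub1 hH).
    move=> [hy _ /IH hl]; rewrite big_cons; apply: (subM hH) => //.
    by case: b hy => hy; [exact: GH | exact: QH].
  by apply: (subM hH); [apply: (subM hH) => // |]; exact/GH/ZG.
have posG' g : G g -> g <> 1%g -> exists2 e, 0 < e & ~ scl_lt H [:: g] e.
  move=> Gg ne; have [e ep he] := posG Gg ne; exists e => // /refl h; apply: he; apply: h.
  by move=> x; rewrite inE => /eqP ->.
have tfG g : G g -> (g * g = 1)%g -> g = 1%g by exact: positive_torsion_free.
have posQ a : A a -> psi a <> 1%g -> exists2 e, 0 < e & ~ scl_lt H [:: psi a] e.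
  move=> ha ne; have a0 : a <> 0 by move=> a0; apply: ne; rewrite a0 (psi0 am).
  case: (pselect (exists2 z, Z z & z <> 1%g)) => [zn|zt].
    have [n [np Gn nn]] := amalgam_pow_in_G ha a0 zn.
    have [e ep he] := posG' _ Gn nn.
    have n0 : 0 < n%:R :> RR by rewrite ltr0n.
    exists (e / n%:R); first by rewrite divr_gt0.
    move=> /(scl_lt_pow np); rewrite mulrC divfK ?lt0r_neq0 //.
  exists 1; first exact: ltr01.
  move=> [n [k [np /clpow1 hk _]]]; apply: (amalgam_trivial_pow _ ha a0 np hk).
  by move=> z hz; apply: contrapT => zn; apply: zt; exists z.
have tfQ a : A a -> (psi a * psi a = 1)%g -> psi a = 1%g.
  move=> ha e2; apply: contrapT => /(posQ a ha)[e ep []].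
  have [M Mp hM] := exists_natM_gt 1 ep.
  exists (2 * M)%N, 0%N; split; first by rewrite muln_gt0.
    by apply/clpow1; rewrite expgnA expg2 e2 expg1n; exact: comm_prod0.
  by rewrite /= add0n natrM; lra.
have conj1 (t g : U) : (t * g * t^-1 = 1)%g -> g = 1%g.
  by move=> e; apply: (mulgI t); apply: (mulIg t^-1%g); rewrite e mulg1 mulgV.
have conj2 (t g : U) : (g * g = 1)%g -> ((t * g * t^-1) * (t * g * t^-1) = 1)%g.
  move=> e; have -> : (t * g * t^-1 * (t * g * t^-1) = t * (g * g) * t^-1)%g by grp.
  by rewrite e mulg1 mulgV.
have tf q : generated G Q Z q -> (q * q = 1)%g -> q = 1%g.
  move=> gq q2; have [t gt [h|h|[b [w [red wn ev e]]]]] := cyclically_reduced hG hQ hZ ZG ZQ nz gq.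
  - by apply: (conj1 t); apply: tfG => //; exact: conj2.
  - by apply: (conj1 t); move: (conj2 t q q2); case: h => a ha ->; exact: tfQ.
  (* An even reduced word is squared without cancellation, so its square is nontrivial. *)
  - have /nz : reduced G Q Z b (w ++ w) by apply/reduced_cat; rewrite (negbTE ev) addbF.
    rewrite big_cat /= -e (conj2 t q q2); case; first by case: (w) wn.
    exact: (sub1 hZ).
move=> g Hg ne.
have [t gt cases] := cyclically_reduced hG hQ hZ ZG ZQ nz (H_gen g Hg).
have Ht := gen_H t gt.
have cne : (t * g * t^-1)%g <> 1%g by move/conj1.
suff [e ep he] : exists2 e, 0 < e & ~ scl_lt H [:: (t * g * t^-1)%g] e.
  by exists e => // /(scl_lt_conj hH Ht).
case: cases => [h|h|[b [w [red wn ev e]]]].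
- exact: posG'.
- by case: h cne => a ha ->; exact: posQ.
have hyp := hyperbolic_comm_prod hG hQ hZ ZG ZQ nz mal tf red wn ev.
(* [c] is the factor in [hyp]: if the power [n.+1] is a product of [k] commutators, then
   [n <= c * k], which contradicts a rate below [1 / (c + 1)]. *)
pose c : nat := (4 * (4 * (2 * size w) + 4))%N.
exists (c + 1)%:R^-1; first by rewrite invr_gt0 ltr0n addn1.
rewrite e => -[[|n] [k [// _ /clpow1 hk small]]].
have h1 : ((k + 1) * (c + 1) < n.+1)%N.
  by move: small; rewrite mulrC ltr_pdivlMr ?ltr0n ?addn1 // -natrM ltr_nat.
have := hyp n k (comm_prod_mono H_gen hk).
by move: h1; rewrite /c; nia.
Qed.

End Positivity.

(** * From single extensions to the whole tower *)

Theorem theorem3p4 (U : groupType) (I : Type) (lt : I -> I -> Prop)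
    (j0 alpha : I) (S : I -> U -> Prop) :
  well_order lt ->
  (forall j, j = j0 \/ lt j0 j) ->
  (forall j, j = alpha \/ lt j alpha) ->
  (iterated_extension (@rational_extension U) lt S ->
     scl_isometric (S j0) (S alpha)) /\
  (iterated_extension (@malnormal_rational_extension U) lt S ->
     (forall g, S j0 g -> g <> 1%g -> (0 < scl_elt (S j0) g)%E) ->
     (forall g, S alpha g -> g <> 1%g -> (0 < scl_elt (S alpha) g)%E)).
Proof.
move=> wo min max; split=> it.
  have hj := tower_subgroup it; case: (min alpha) => [<- //|ja].
  apply: isometric_of_scl_lt => //; first by move=> x; exact: (tower_mono it ja).
  exact: (tower_reflecting wo it).
have hj := tower_subgroup it => pos0.
have rat G H : malnormal_rational_extension G H -> @rational_extension U G H.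
  by move=> [A [Z [phi [psi [am _]]]]]; exists A, Z, phi, psi.
suff pos j : scl_positive (S j).
  by move=> g Sg ne; apply/(scl_elt_gt0 (hj alpha) Sg); exact: pos.
have [irr [tr [tri wf]]] := wo.
elim: (wf j) => {}j _ IH.
case: (min j) => [->|j0j].
  by move=> g Sg ne; apply/(scl_elt_gt0 (hj j0) Sg); exact: pos0.
case: (succ_or_limit j0j) => [[i ij]|lim].
  have [_ [_ [step _]]] := it.
  have [A [Z [phi [psi [am mal]]]]] := step i j ij.
  by apply: (amalgam_positive (hj i) (hj j) am mal); apply: IH; case: ij.
(* At a limit, [g] lies in an earlier stage, where it has positive [scl] by induction; the isometry
   carries the bound up. *)
move=> g Sg ne.
have [_ [_ [_ /(_ j lim g) [/(_ Sg) [i [ij Sig]] _]]]] := it.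
have [e ep he] := IH i ij g Sig ne; exists e => // h; apply: he.
apply: (tower_reflecting wo it rat ij) h => x; rewrite inE => /eqP -> //.
Qed.
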